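(* Let $E,F$ be finite, essential, strongly connected graphs that satisfy Condition (L), and let $R$ be a unital subring of $\mathbb C$ closed under complex conjugation. If $\phi\colon L_R(E)\to L_R(F)$ is a $*$-isomorphism with $\phi(\mathcal D(L_R(E)))\subseteq\mathcal D(L_R(F))$, then $\operatorname{sgn}(\det(I-A_E))=\operatorname{sgn}(\det(I-A_F))$.
   Context: A graph $E=(E^0,E^1,r,s)$ has vertices $E^0$, edges $E^1$, and range and source maps $r,s$. A path is a word $e_1\cdots e_n$ with $r(e_i)=s(e_{i+1})$; vertices are paths of length $0$; $E^*$ is the set of finite paths. The adjacency matrix $A_E$ is the $E^0\times E^0$ matrix with $A_E(v,w)=|s^{-1}(v)\cap r^{-1}(w)|$. $E$ is strongly connected if there is a path between any two vertices; essential if it has no sinks or sources; and satisfies Condition (L) if every cycle has an exit. The Leavitt path algebra $L_R(E)$ is the universal $R$-algebra generated by pairwise orthogonal idempotents $\{v\}_{v\in E^0}$ and $\{e,e^*\}_{e\in E^1}$ with: $e^*f=0$ for $e\ne f$; $e^*e=r(e)$; $s(e)e=e=er(e)$; $e^*s(e)=e^*=r(e)e^*$; and $v=\sum_{e\in s^{-1}(v)}ee^*$ whenever $s^{-1}(v)$ is finite and nonempty. For $\alpha=e_1\cdots e_n$ put $\alpha^*=e_n^*\cdots e_1^*$. $L_R(E)$ carries the conjugate-linear involution $(\lambda\alpha\beta^* )^*=\overline\lambda\beta\alpha^*$. Its diagonal is $\mathcal D(L_R(E))=\mathrm{span}_R\{\alpha\alpha^*\mid\alpha\in E^*\}$. 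*)

(* Defs.v *)
From HB Require Import structures.
From Stdlib Require Import Rdefinitions.
From mathcomp Require Import all_boot all_order all_algebra.
Set Implicit Arguments. Unset Strict Implicit. Unset Printing Implicit Defensive.
Import Order.TTheory GRing.Theory Num.Theory.
Local Open Scope ring_scope.

Record cplx := Cpair { Cre : Rdefinitions.R ; Cim : Rdefinitions.R }.
Definition C0 : cplx := Cpair R0 R0.
Definition C1 : cplx := Cpair R1 R0.
Definition Cadd (a b : cplx) : cplx := Cpair (Rplus (Cre a) (Cre b)) (Rplus (Cim a) (Cim b)).
Definition Copp (a : cplx) : cplx := Cpair (Ropp (Cre a)) (Ropp (Cim a)).
Definition Cmul (a b : cplx) : cplx :=
  Cpair (Rminus (Rmult (Cre a) (Cre b)) (Rmult (Cim a) (Cim b)))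
        (Rplus (Rmult (Cre a) (Cim b)) (Rmult (Cim a) (Cre b))).
Definition Cconj (a : cplx) : cplx := Cpair (Cre a) (Ropp (Cim a)).

Definition conj_closed_unital_subring (S : cplx -> Prop) : Prop :=
  [/\ S C1,
      (forall a b, S a -> S b -> S (Cadd a b)),
      (forall a, S a -> S (Copp a)),
      (forall a b, S a -> S b -> S (Cmul a b)) &
      (forall a, S a -> S (Cconj a))].

Record lgraph := LGraph {
  gV : finType;
  gE : finType;
  src : gE -> gV;
  rng : gE -> gV
}.

Section Graphs.
Variable G : lgraph.

(* [gpath v p] : p = e_1 ... e_n is a path starting at v, i.e. s(e_1) = v and
   r(e_i) = s(e_{i+1}); the empty list represents the vertex v (length 0). *)
Fixpoint gpath (v : gV G) (p : seq (gE G)) : bool :=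
  match p with
  | [::] => true
  | e :: p' => (src e == v) && gpath (rng e) p'
  end.

Definition gend (v : gV G) (p : seq (gE G)) : gV G := last v (map (@rng G) p).

Definition strongly_connected : Prop :=
  forall v w : gV G, exists p, gpath v p /\ gend v p = w.

Definition is_sink (v : gV G) : Prop := forall e : gE G, src e != v.
Definition is_source (v : gV G) : Prop := forall e : gE G, rng e != v.
Definition essential : Prop := forall v : gV G, ~ is_sink v /\ ~ is_source v.

Definition is_cycle (p : seq (gE G)) : Prop :=
  exists v, [/\ p != [::], gpath v p, gend v p = v & uniq (map (@src G) p)].

Definition has_exit (p : seq (gE G)) : Prop :=
  exists f : gE G, exists2 e, e \in p & (src f = src e /\ f != e).

Definition condition_L : Prop := forall p, is_cycle p -> has_exit p.

Definition adjmx : 'M[int]_#|gV G| :=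
  \matrix_(i, j) (#|[set e : gE G | (src e == enum_val i) && (rng e == enum_val j)]| : int).

End Graphs.

Section Alg.
Variable S : cplx -> Prop.

(* A unital R-algebra structure on the ring B: a unital ring morphism
   iota : R -> Z(B) (only its values on R matter). *)
Definition ralg (B : pzRingType) (iota : cplx -> B) : Prop :=
  [/\ iota C1 = 1,
      (forall a b, S a -> S b -> iota (Cadd a b) = iota a + iota b),
      (forall a b, S a -> S b -> iota (Cmul a b) = iota a * iota b) &
      (forall a x, S a -> iota a * x = x * iota a)].

Definition ralg_hom (A B : pzRingType) (iA : cplx -> A) (iB : cplx -> B) (f : A -> B) : Prop :=
  [/\ (forall x y, f (x + y) = f x + f y),
      (forall x y, f (x * y) = f x * f y),
      f 1 = 1 &
      (forall a x, S a -> f (iA a * x) = iB a * f x)].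

Variable G : lgraph.

(* Leavitt G-family (P v = v, X e = e, Y e = e^* ) in the ring B *)
Definition leavitt_family (B : pzRingType) (P : gV G -> B) (X Y : gE G -> B) : Prop :=
  (forall v, P v * P v = P v) /\
  (forall v w, v != w -> P v * P w = 0) /\
  (forall e f, e != f -> Y e * X f = 0) /\
  (forall e, Y e * X e = P (rng e)) /\
  (forall e, P (src e) * X e = X e /\ X e * P (rng e) = X e) /\
  (forall e, Y e * P (src e) = Y e /\ P (rng e) * Y e = Y e) /\
  (forall v, (exists e, src e = v) ->
             P v = \sum_(e : gE G | src e == v) X e * Y e).

(* Since G is finite, L_R(G) is unital with unit \sum_v v; it is the initial
   object among unital R-algebras carrying a Leavitt G-family with \sum_v v = 1. *)
Definition unital_leavitt_family (B : pzRingType) (P : gV G -> B) (X Y : gE G -> B) : Prop :=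
  leavitt_family P X Y /\ \sum_(v : gV G) P v = 1.

(* the canonical involution: conjugate-linear, antimultiplicative, involutive,
   v^* = v, (e)^* = e^*  (so (lambda alpha beta^* )^* = conj(lambda) beta alpha^* ) *)
Definition lpa_star (A : pzRingType) (iA : cplx -> A) (st : A -> A)
    (P : gV G -> A) (X Y : gE G -> A) : Prop :=
  (forall x y, st (x + y) = st x + st y) /\
  (forall x y, st (x * y) = st y * st x) /\
  (forall x, st (st x) = x) /\
  (forall a, S a -> st (iA a) = iA (Cconj a)) /\
  (forall v, st (P v) = P v) /\
  (forall e, st (X e) = Y e).

(* (A, iA, st, P, X, Y) is (an isomorphic copy of) the Leavitt path *-algebra L_R(G)
   with its generators and involution, characterised by its universal property. *)
Definition is_LPA (A : pzRingType) (iA : cplx -> A) (st : A -> A)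
    (P : gV G -> A) (X Y : gE G -> A) : Prop :=
  [/\ ralg iA,
      unital_leavitt_family P X Y,
      lpa_star iA st P X Y &
      forall (B : pzRingType) (iB : cplx -> B) (PB : gV G -> B) (XB YB : gE G -> B),
        ralg iB -> unital_leavitt_family PB XB YB ->
        exists f : A -> B,
          [/\ ralg_hom iA iB f,
              (forall v, f (P v) = PB v),
              (forall e, f (X e) = XB e),
              (forall e, f (Y e) = YB e) &
              (forall g : A -> B, ralg_hom iA iB g ->
                 (forall v, g (P v) = PB v) -> (forall e, g (X e) = XB e) ->
                 (forall e, g (Y e) = YB e) -> forall x, g x = f x)]].

Definition path_mono (A : pzRingType) (P : gV G -> A) (X : gE G -> A) (v : gV G) (p : seq (gE G)) : A :=
  P v * \prod_(e <- p) X e.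
Definition path_adj (A : pzRingType) (P : gV G -> A) (Y : gE G -> A) (v : gV G) (p : seq (gE G)) : A :=
  (\prod_(e <- rev p) Y e) * P v.

Definition in_diagonal (A : pzRingType) (iA : cplx -> A) (P : gV G -> A) (X Y : gE G -> A) (x : A) : Prop :=
  exists n (c : 'I_n -> cplx) (v : 'I_n -> gV G) (p : 'I_n -> seq (gE G)),
    (forall i, S (c i) /\ gpath (v i) (p i)) /\
    x = \sum_(i < n) iA (c i) * (path_mono P X (v i) (p i) * path_adj P Y (v i) (p i)).

End Alg.

Definition star_iso (S : cplx -> Prop) (A B : pzRingType) (iA : cplx -> A) (iB : cplx -> B)
    (stA : A -> A) (stB : B -> B) (phi : A -> B) : Prop :=
  [/\ bijective phi,
      (forall x y, phi (x + y) = phi x + phi y),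
      (forall x y, phi (x * y) = phi x * phi y),
      (forall a x, S a -> phi (iA a * x) = iB a * phi x) &
      (forall x, phi (stA x) = stB (phi x))].

(* Main.v *)
(* The isomorphism phi carries the diagonal of L(E) onto that of L(F), because the diagonal is maximal
   abelian (Condition (L)). So one ring B carries two Leavitt families with the same diagonal D, and each
   path of one family normalizes D. By (L) a normalizer maps every sufficiently small cylinder of the
   other family to a single cylinder, up to a scalar of modulus 1. After replacing E by an iterated line
   graph G, which keeps det(1 - A), every edge e of G is homogeneous, of degree c(e) say, for the length
   grading of L(F).

   Let A_c(t) be the adjacency matrix of G with each edge e weighted by t^c(e). The Z[t,1/t]-module
   generated by the projections of D, with [p + q] = [p] + [q] for orthogonal p and q and
   [n n^*] = t^k [n^* n] for normalizers n of degree k, is presented both by 1 - A_c(t) and by 1 - t A_F.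
   Hence the two determinants divide each other in Z[t,1/t]. Closed paths of G have positive weight, so
   both determinants are polynomials with constant term 1, and therefore equal. At t = 1 this gives
   det(1 - A_E) = det(1 - A_F). *)

Require Import Defs.
From HB Require Import structures.
From Stdlib Require Import Rdefinitions RIneq.
From mathcomp Require Import all_boot all_order all_algebra all_fingroup.
From mathcomp Require Import boolp functions.
Set Implicit Arguments. Unset Strict Implicit. Unset Printing Implicit Defensive.
Import Order.TTheory GRing.Theory Num.Theory.
Local Open Scope ring_scope.
Delimit Scope R_scope with coqR.

(** * Coefficients *)

(** The variable t is what decides the sign. With t = 1 throughout, mutual divisibility in Z would
    give the determinants only up to sign; over Z[t,1/t] the quotient is a unit, and constant terms
    1 leave only the unit 1.

    Line graphs enter because an edge of E is in general a sum of pieces of different F-degrees.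
    Vertices of the N-th line graph are cylinders of length N of E; for large N each cuts an edge
    down to a single piece.

    The involution makes scalars unitary: if n q = b a for paths q and a, then b has modulus 1 and n
    q q^* n^* is exactly a a^*. So normalizers move cylinders to cylinders.

    A universal property alone never shows that an element is nonzero. Two representations by
    endomorphisms supply what is missing: functions on infinite paths show that no nonzero scalar
    kills a vertex, and Z-indexed sequences in A yield the grading.

    The diagonal is handled as [level], the elements acting by a scalar on each long path. This uses
    left multiplication only, so commutation and the passage to line graphs are immediate. *)

Lemma cplx_ext (a b : cplx) : Cre a = Cre b -> Cim a = Cim b -> a = b.
Proof. by case: a b => [? ?] [? ?] /= -> ->. Qed.

Lemma CaddA : associative Cadd.
Proof. by move=> a b c; apply: cplx_ext => /=; ring. Qed.
Lemma CaddC : commutative Cadd.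
Proof. by move=> a b; apply: cplx_ext => /=; ring. Qed.
Lemma Cadd0 : left_id C0 Cadd.
Proof. by move=> a; apply: cplx_ext => /=; ring. Qed.
Lemma CaddN : left_inverse C0 Copp Cadd.
Proof. by move=> a; apply: cplx_ext => /=; ring. Qed.
Lemma CmulA : associative Cmul.
Proof. by move=> a b c; apply: cplx_ext => /=; ring. Qed.
Lemma CmulC : commutative Cmul.
Proof. by move=> a b; apply: cplx_ext => /=; ring. Qed.
Lemma Cmul1 : left_id C1 Cmul.
Proof. by move=> a; apply: cplx_ext => /=; ring. Qed.
Lemma CmulD : left_distributive Cmul Cadd.
Proof. by move=> a b c; apply: cplx_ext => /=; ring. Qed.

HB.instance Definition _ := gen_eqMixin cplx.
HB.instance Definition _ := gen_choiceMixin cplx.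
HB.instance Definition _ := GRing.isZmodule.Build cplx CaddA CaddC Cadd0 CaddN.
HB.instance Definition _ := GRing.Zmodule_isComPzRing.Build cplx CmulA CmulC Cmul1 CmulD.

Lemma cplx_mul_eq0 (a b : cplx) : a * b = 0 -> a = 0 \/ b = 0.
Proof.
case: a b => [x y] [u v] [h1 h2].
have h : ((x*x+y*y)*(u*u+v*v) = 0)%coqR.
  (* Multiplicativity of the squared modulus. *)
  have -> : ((x*x+y*y)*(u*u+v*v) = (x*u-y*v)*(x*u-y*v)+(x*v+y*u)*(x*v+y*u))%coqR by ring.
  have e1 : (x*u-y*v = 0)%coqR by exact: h1.
  have e2 : (x*v+y*u = 0)%coqR by exact: h2.
  by rewrite e1 e2; ring.
case: (Rmult_integral _ _ h) => /Rplus_sqr_eq_0 [-> ->]; [left|right]; exact: cplx_ext.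
Qed.

Lemma cplx_natr_inj (m n : nat) : (m%:R : cplx) = n%:R -> m = n.
Proof.
have re k : Cre (k%:R) = INR k.
  elim: k => // k IH; rewrite mulrSr S_INR -IH; reflexivity.
by move=> /(congr1 Cre); rewrite !re => /INR_eq.
Qed.

(* Imported only now: this [ring] does not see the ring structure of the Stdlib reals used above. *)
From mathcomp Require Import zify ring.

(* Endomorphisms are required to commute with [act], which makes the scalars central among them. *)
Record scal_act (M : zmodType) := ScalAct {
  act :> cplx -> M -> M ;
  act_add : forall c, {morph act c : x y / x + y} ;
  act_comm : forall c d x, act c (act d x) = act d (act c x) }.

Section Endomorphisms.
Variables (M : zmodType) (T : scal_act M).

Record endo := Endo {
  endo_fun :> M -> M ;
  endoD : {morph endo_fun : x y / x + y} ;
  endoZ : forall c x, endo_fun (T c x) = T c (endo_fun x) }.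

Lemma act0 (c : cplx) : T c 0 = 0.
Proof. by apply: (@addrI _ (T c 0)); rewrite -(act_add T) !addr0. Qed.
Lemma actN c x : T c (- x) = - T c x.
Proof. by apply: (@addrI _ (T c x)); rewrite -(act_add T) !addrN act0. Qed.

Lemma endo_ext (f g : endo) : (forall x, f x = g x) -> f = g.
Proof.
case: f g => [f hf hf'] [g hg hg'] /= h; have e : f = g by exact: funext.
by subst g; congr Endo; exact: Prop_irrelevance.
Qed.

Definition endo_zero : endo.
Proof. by exists (fun _ => 0) => [x y|c x]; rewrite ?addr0 ?act0. Defined.
Definition endo_one : endo.
Proof. by exists id. Defined.
Definition endo_opp (f : endo) : endo.
Proof. by exists (fun x => - f x) => [x y|c x]; rewrite ?endoD ?endoZ ?opprD ?actN. Defined.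
Definition endo_add (f g : endo) : endo.
Proof.
by exists (fun x => f x + g x) => [x y|c x]; rewrite ?endoD ?endoZ ?(act_add T) // addrACA.
Defined.
Definition endo_mul (f g : endo) : endo.
Proof. by exists (fun x => f (g x)) => [x y|c x]; rewrite ?endoD ?endoZ. Defined.
Definition endo_act (c : cplx) := @Endo (T c) (act_add T c) (fun d x => act_comm T c d x).

HB.instance Definition _ := gen_eqMixin endo.
HB.instance Definition _ := gen_choiceMixin endo.

Lemma endo_addA : associative endo_add.
Proof. by move=> f g h; apply: endo_ext => x /=; rewrite addrA. Qed.
Lemma endo_addC : commutative endo_add.
Proof. by move=> f g; apply: endo_ext => x /=; rewrite addrC. Qed.
Lemma endo_add0 : left_id endo_zero endo_add.
Proof. by move=> f; apply: endo_ext => x /=; rewrite add0r. Qed.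
Lemma endo_addN : left_inverse endo_zero endo_opp endo_add.
Proof. by move=> f; apply: endo_ext => x /=; rewrite addNr. Qed.
HB.instance Definition _ := GRing.isZmodule.Build endo endo_addA endo_addC endo_add0 endo_addN.

Lemma endo_mulA : associative endo_mul.
Proof. by move=> f g h; apply: endo_ext. Qed.
Lemma endo_mul1 : left_id endo_one endo_mul.
Proof. by move=> f; apply: endo_ext. Qed.
Lemma endo_mulr1 : right_id endo_one endo_mul.
Proof. by move=> f; apply: endo_ext. Qed.
Lemma endo_mulDl : left_distributive endo_mul endo_add.
Proof. by move=> f g h; apply: endo_ext. Qed.
Lemma endo_mulDr : right_distributive endo_mul endo_add.
Proof. by move=> f g h; apply: endo_ext => x /=; rewrite endoD. Qed.
HB.instance Definition _ :=
  GRing.Zmodule_isPzRing.Build endo endo_mulA endo_mul1 endo_mulr1 endo_mulDl endo_mulDr.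

Lemma endo_sumE (I : finType) (P : pred I) (F : I -> endo) x :
  (\sum_(i | P i) F i) x = \sum_(i | P i) F i x.
Proof. by elim/big_rec2: _ => // i y z _ <-. Qed.
End Endomorphisms.

Section Scalars.
Variables (S : cplx -> Prop) (hS : conj_closed_unital_subring S).

Lemma scal1 : S 1. Proof. by case: hS. Qed.
Lemma scalD a b : S a -> S b -> S (a + b). Proof. by case: hS => _ h _ _ _; exact: h. Qed.
Lemma scalN a : S a -> S (- a). Proof. by case: hS => _ _ h _ _; exact: h. Qed.
Lemma scalM a b : S a -> S b -> S (a * b). Proof. by case: hS => _ _ _ h _; exact: h. Qed.
Lemma scalC a : S a -> S (Cconj a). Proof. by case: hS => _ _ _ _ h; exact: h. Qed.
Lemma scal0 : S 0. Proof. by rewrite -(addrN 1); exact: scalD scal1 (scalN scal1). Qed.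
Lemma scalB a b : S a -> S b -> S (a - b). Proof. by move=> ha hb; apply: scalD (scalN hb). Qed.
Lemma scaln n : S n%:R.
Proof. by elim: n => [|n IH]; [exact: scal0 | rewrite mulrSr; exact: scalD IH scal1]. Qed.

Variables (B : pzRingType) (iB : cplx -> B) (hB : ralg S iB).

Lemma ralg1 : iB 1 = 1. Proof. by case: hB. Qed.
Lemma ralgD a b : S a -> S b -> iB (a + b) = iB a + iB b. Proof. by case: hB => _ h _ _; exact: h. Qed.
Lemma ralgM a b : S a -> S b -> iB (a * b) = iB a * iB b. Proof. by case: hB => _ _ h _; exact: h. Qed.
Lemma ralgZ a x : S a -> iB a * x = x * iB a. Proof. by case: hB => _ _ _ h; exact: h. Qed.
Lemma ralg0 : iB 0 = 0.
Proof. by apply: (@addrI _ (iB 0)); rewrite -ralgD ?addr0 //; exact: scal0. Qed.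
Lemma ralgN a : S a -> iB (- a) = - iB a.
Proof. by move=> ha; apply: (@addrI _ (iB a)); rewrite -ralgD ?addrN ?ralg0 //; exact: scalN. Qed.
Lemma ralgB a b : S a -> S b -> iB (a - b) = iB a - iB b.
Proof. by move=> ha hb; rewrite ralgD ?ralgN //; exact: scalN. Qed.
Lemma ralgn n : iB n%:R = n%:R.
Proof.
elim: n => [|n IH]; first exact: ralg0.
by rewrite !mulrSr ralgD ?IH ?ralg1 //; [exact: scaln | exact: scal1].
Qed.
End Scalars.

(** * Leavitt path algebras *)

Section GeneratorInduction.
Variables (S : cplx -> Prop) (hS : conj_closed_unital_subring S) (G : lgraph).
Variables (A : pzRingType) (iA : cplx -> A) (stA : A -> A).
Variables (P : gV G -> A) (X Y : gE G -> A) (hA : is_LPA S iA stA P X Y).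
Variable Q : A -> Prop.
Hypothesis hQB : forall x y, Q x -> Q y -> Q (x - y).
Hypothesis hQM : forall x y, Q x -> Q y -> Q (x * y).
Hypothesis hQi : forall c, S c -> Q (iA c).
Hypothesis hQP : forall v, Q (P v).
Hypothesis hQX : forall e, Q (X e).
Hypothesis hQY : forall e, Q (Y e).

Let hral : ralg S iA. Proof. by case: hA. Qed.
Let hQ1 : Q 1. Proof. by rewrite -(ralg1 hral); apply: hQi; exact: scal1 hS. Qed.

Let Qb : {pred A} := fun x => `[<Q x>].
Lemma Qb_closed : subring_closed Qb.
Proof.
by split=> [|x y /asboolP hx /asboolP hy|x y /asboolP hx /asboolP hy]; apply/asboolP;
  [exact: hQ1 | exact: hQB | exact: hQM].
Qed.
HB.instance Definition _ := GRing.isSubringClosed.Build A Qb Qb_closed.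
Record subQ := SubQ { subQ_val :> A ; _ : subQ_val \in Qb }.
HB.instance Definition _ := [isSub for subQ_val].
HB.instance Definition _ := [Choice of subQ by <:].
HB.instance Definition _ := GRing.SubChoice_isSubPzRing.Build A Qb subQ Qb_closed.

(** The default 1 can occur only off [Q], for instance at [iA c] with c outside S, where [ralg]
    demands nothing. *)
Let mkQ (x : A) : subQ := insubd (1 : subQ) x.
Let mkQE x : Q x -> val (mkQ x) = x.
Proof. by move=> hx; rewrite val_insubd; case: ifP => //; move/asboolP. Qed.

(** The elements satisfying [Q] form a subring containing the generators, so the universal property
    maps A into it; followed by the inclusion, this map is the identity by uniqueness. *)
Lemma lpa_ind : forall x, Q x.
Proof.
case: hA => _ [[h1 [h2 [h3 [h4 [h5 [h6 h7]]]]]] hsum] _ hU.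
pose iQ c := mkQ (iA c).
have vD (x y : subQ) : val (x + y) = val x + val y by [].
have vM (x y : subQ) : val (x * y) = val x * val y by [].
have v1 : val (1 : subQ) = 1 by [].
have hiQ : ralg S iQ.
  split=> [|a b ha hb|a b ha hb|a x ha]; apply: val_inj; rewrite ?vD ?vM ?v1 !mkQE;
    do ?[apply: hQi] => //.
  - exact: ralg1 hral.
  - exact: scal1 hS.
  - exact: ralgD hral _ _ ha hb.
  - exact: scalD hS _ _ ha hb.
  - exact: ralgM hral _ _ ha hb.
  - exact: scalM hS _ _ ha hb.
  - exact: ralgZ hral _ _ ha.
have hfam : unital_leavitt_family (mkQ \o P) (mkQ \o X) (mkQ \o Y).
  have vsum (I : finType) (p : pred I) (F : I -> subQ) : val (\sum_(i | p i) F i) = \sum_(i | p i) val (F i).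
    by elim/big_rec2: _ => // i y z _ <-.
  split; last first.
    by apply: val_inj; rewrite vsum v1 -hsum; apply: eq_bigr => v _; rewrite mkQE.
  split; first by move=> v; apply: val_inj; rewrite vM /= !mkQE ?h1.
  split; first by move=> v w vw; apply: val_inj; rewrite vM /= !mkQE ?h2.
  split; first by move=> v w vw; apply: val_inj; rewrite vM /= !mkQE ?h3.
  split; first by move=> v; apply: val_inj; rewrite vM /= !mkQE ?h4.
  split; first by move=> e; case: (h5 e) => a b; split; apply: val_inj; rewrite vM /= !mkQE.
  split; first by move=> e; case: (h6 e) => a b; split; apply: val_inj; rewrite vM /= !mkQE.
  move=> v hv; apply: val_inj; rewrite vsum mkQE // h7 //; apply: eq_bigr => e _.
  by rewrite vM !mkQE.
have [f [[fD fM f1 fi] fP fX fY _]] := hU _ _ _ _ _ hiQ hfam.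
(* The unique endomorphism of A fixing the generators; both [val \o f] and the identity must equal
   it. *)
have [g [_ _ _ _ gu]] := hU _ _ _ _ _ hral (conj (conj h1 (conj h2 (conj h3 (conj h4 (conj h5 (conj h6 h7)))))) hsum).
move=> x.
have e1 : val (f x) = g x.
  apply: (gu (fun x => val (f x))) => //.
  - split=> [a b|a b||a b ha]; rewrite ?fD ?f1 //; first by rewrite fM.
    by rewrite fi // vM mkQE //; exact: hQi.
  - by move=> v; rewrite fP /= mkQE.
  - by move=> v; rewrite fX /= mkQE.
  - by move=> v; rewrite fY /= mkQE.
have e2 : x = g x by apply: (gu id).
rewrite e2 -e1; by case: (f x) => y hy /=; apply/asboolP.
Qed.
End GeneratorInduction.

Section Paths.
Variable G : lgraph.

Definition vpath := (gV G * seq (gE G))%type.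
Definition okpath (q : vpath) := gpath q.1 q.2.
Definition path_end (q : vpath) := gend q.1 q.2.
Definition plen (q : vpath) := size q.2.
Definition catp (q : vpath) (p : seq (gE G)) : vpath := (q.1, q.2 ++ p).

Lemma gpath_cat (v : gV G) p p' : gpath v (p ++ p') = gpath v p && gpath (gend v p) p'.
Proof. by elim: p v => //= e p IH v; rewrite IH andbA. Qed.

Lemma gend_cat (v : gV G) p p' : gend v (p ++ p') = gend (gend v p) p'.
Proof. by rewrite /gend map_cat last_cat. Qed.

Lemma okpath_catp q p : okpath (catp q p) = okpath q && gpath (path_end q) p.
Proof. exact: gpath_cat. Qed.
Lemma path_end_catp q p : path_end (catp q p) = gend (path_end q) p.
Proof. exact: gend_cat. Qed.
Lemma plen_catp q p : plen (catp q p) = (plen q + size p)%N.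
Proof. exact: size_cat. Qed.
Lemma catp_nil q : catp q [::] = q.
Proof. by case: q => v p; rewrite /catp cats0. Qed.
Lemma catp_inj q q' p : catp q p = catp q' p -> q = q'.
Proof.
case: q q' => v r [v' r']; rewrite /catp /= => -[-> h]; congr pair.
by move/(congr1 rev): h; rewrite !rev_cat => /eqP; rewrite eqseq_cat // eqxx => /eqP /(can_inj revK).
Qed.

Fixpoint paths_from (w : gV G) (k : nat) : seq (seq (gE G)) :=
  if k is k'.+1
  then flatten [seq [seq e :: p | p <- paths_from (rng e) k'] | e <- enum (gE G) & src e == w]
  else [:: [::]].

Lemma mem_paths_from w k p : (p \in paths_from w k) = gpath w p && (size p == k).
Proof.
elim: k w p => [|k IH] w p /=; first by rewrite inE; case: p => //= e p; rewrite andbF.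
apply/flattenP/idP => [[x /mapP[e]]|].
  rewrite mem_filter => /andP[/eqP se _] -> /mapP[p' ]; rewrite IH => /andP[h /eqP hs] ->.
  by rewrite /= se eqxx h hs eqxx.
case: p => [|e p] //= /andP[/andP[/eqP se h] hs].
exists [seq e :: p | p <- paths_from (rng e) k].
  by apply/mapP; exists e => //; rewrite mem_filter se eqxx mem_enum.
by apply/mapP; exists p => //; rewrite IH h.
Qed.

Lemma uniq_paths_from w k : uniq (paths_from w k).
Proof.
elim: k w => //= k IH w.
elim: [seq _ <- _ | _] (filter_uniq (fun e => src e == w) (enum_uniq (gE G))) => //= e s IHs /andP[es us].
rewrite cat_uniq IHs // (map_inj_uniq) ?IH ?andbT => [|? ? [] //].
apply/hasPn => p /flattenP[_ /mapP[f fs ->] /mapP[p' _ ->]].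
by apply/negP => /mapP[p'' _ [ef _]]; rewrite -ef fs in es.
Qed.

Definition paths_of_len (k : nat) : seq vpath := [seq (v, p) | v <- enum (gV G), p <- paths_from v k].

Lemma mem_paths_of_len k q : (q \in paths_of_len k) = okpath q && (plen q == k).
Proof.
apply/allpairsPdep/idP => [[v [p [_ h ->]]]|]; first by rewrite mem_paths_from in h.
by case: q => v p h; exists v, p; rewrite mem_enum mem_paths_from.
Qed.

Lemma uniq_paths_of_len k : uniq (paths_of_len k).
Proof.
apply: allpairs_uniq_dep; [exact: enum_uniq | move=> v _; exact: uniq_paths_from|].
by move=> [v p] [w r] _ _ /= [-> ->].
Qed.

Definition nosink := forall v : gV G, exists e : gE G, src e = v.

Lemma paths_from_nonnil (hG : nosink) w k : exists p, p \in paths_from w k.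
Proof.
elim: k w => [|k IH] w; first by exists [::]; rewrite inE.
have [e se] := hG w; have [p] := IH (rng e); rewrite mem_paths_from => /andP[h1 /eqP h2].
by exists (e :: p); rewrite mem_paths_from /= se eqxx h1 h2 eqxx.
Qed.

(** Without sinks every path extends. The counting in [closed_weight_pos] rests on this
    monotonicity. *)
Lemma size_paths_fromS (hG : nosink) w k : (size (paths_from w k) <= size (paths_from w k.+1))%N.
Proof.
elim: k w => [|k IH] w.
  have [p] := paths_from_nonnil hG w 1; by case: (paths_from w 1).
rewrite /= !size_flatten /shape -!map_comp.
elim: [seq _ <- _ | _] => //= e s IHs.
by rewrite leq_add // !size_map; exact: IH.
Qed.

Lemma leq_size_paths_from (hG : nosink) w k k' : (k <= k')%N -> (size (paths_from w k) <= size (paths_from w k'))%N.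
Proof.
move=> h; rewrite -(subnKC h); elim: (k' - k)%N => [|j IH]; first by rewrite addn0.
by rewrite addnS; apply: leq_trans IH (size_paths_fromS hG _ _).
Qed.

(* The form of Condition (L) used here; unlike (L) itself it passes to the line graph at once. *)
Definition branching := nosink /\ forall (v : gV G) p, gpath v p -> p != [::] -> gend v p = v ->
  exists2 p', gpath v p' & size p' = size p /\ p' <> p.
End Paths.

Section Family.
Variables (S : cplx -> Prop) (hS : conj_closed_unital_subring S) (G : lgraph).
Variables (B : pzRingType) (iB : cplx -> B) (st : B -> B).
Variables (P : gV G -> B) (X Y : gE G -> B).

(* [mn q] and [ad q] are mu and mu^* for the path mu = q; they are locked because [mulrA] would
   otherwise rewrite inside the products that define them. *)
Definition mn (q : vpath G) : B := locked (path_mono P X q.1 q.2).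
Definition ad (q : vpath G) : B := locked (path_adj P Y q.1 q.2).
Lemma mnE q : mn q = path_mono P X q.1 q.2. Proof. by rewrite /mn -lock. Qed.
Lemma adE q : ad q = path_adj P Y q.1 q.2. Proof. by rewrite /ad -lock. Qed.

Hypothesis hF : unital_leavitt_family P X Y.

Lemma famPP v : P v * P v = P v. Proof. by case: hF => -[h]. Qed.
Lemma famPP0 v w : v != w -> P v * P w = 0. Proof. by case: hF => -[_ [h _]] _; exact: h. Qed.
Lemma famYX0 e f : e != f -> Y e * X f = 0. Proof. by case: hF => -[_ [_ [h _]]] _; exact: h. Qed.
Lemma famYX e : Y e * X e = P (rng e). Proof. by case: hF => -[_ [_ [_ [h _]]]] _; exact: h. Qed.
Lemma famPX e : P (src e) * X e = X e. Proof. by case: hF => -[_ [_ [_ [_ [h _]]]]] _; case: (h e). Qed.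
Lemma famXP e : X e * P (rng e) = X e. Proof. by case: hF => -[_ [_ [_ [_ [h _]]]]] _; case: (h e). Qed.
Lemma famYP e : Y e * P (src e) = Y e. Proof. by case: hF => -[_ [_ [_ [_ [_ [h _]]]]]] _; case: (h e). Qed.
Lemma famPY e : P (rng e) * Y e = Y e. Proof. by case: hF => -[_ [_ [_ [_ [_ [h _]]]]]] _; case: (h e). Qed.
Lemma famP v : (exists e, src e = v) -> P v = \sum_(e : gE G | src e == v) X e * Y e.
Proof. by case: hF => -[_ [_ [_ [_ [_ [_ h]]]]]] _; exact: h. Qed.
Lemma fam1 : \sum_v P v = 1. Proof. by case: hF. Qed.

Lemma mn_nil v : mn (v, [::]) = P v.
Proof. by rewrite !mnE /path_mono big_nil mulr1. Qed.
Lemma mn_cons e p : mn (src e, e :: p) = X e * mn (rng e, p).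
Proof. by rewrite !mnE /path_mono /= big_cons !mulrA famPX famXP. Qed.
Lemma ad_nil v : ad (v, [::]) = P v.
Proof. by rewrite !adE /path_adj big_nil mul1r. Qed.
Lemma ad_cons e p : ad (src e, e :: p) = ad (rng e, p) * Y e.
Proof. by rewrite !adE /path_adj /= rev_cons -cats1 big_cat big_seq1 /= -!mulrA famYP famPY. Qed.
Lemma P_mn q : P q.1 * mn q = mn q.
Proof. by rewrite !mnE /path_mono mulrA famPP. Qed.
Lemma P_mn0 v q : v != q.1 -> P v * mn q = 0.
Proof. by move=> h; rewrite !mnE /path_mono mulrA famPP0 ?mul0r. Qed.
Lemma ad_P q : ad q * P q.1 = ad q.
Proof. by rewrite !adE /path_adj -mulrA famPP. Qed.

Lemma mn_cat q p : okpath q -> mn (catp q p) = mn q * mn (path_end q, p).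
Proof.
case: q => v s; elim: s v => [|e s IH] v /=.
  by rewrite mn_nil => _; exact: esym (P_mn (v, p)).
rewrite {1}/okpath /= => /andP[/eqP <- h]; rewrite /catp /= !mn_cons -mulrA -IH //.
Qed.

Lemma mn_end q : okpath q -> mn q * P (path_end q) = mn q.
Proof. by move=> h; rewrite -(mn_nil (path_end q)) -mn_cat // catp_nil. Qed.

Lemma ad_cat q p : okpath q -> ad (catp q p) = ad (path_end q, p) * ad q.
Proof.
case: q => v s; elim: s v => [|e s IH] v /=.
  by rewrite ad_nil => _; exact: esym (ad_P (v, p)).
rewrite {1}/okpath /= => /andP[/eqP <- h]; rewrite /catp /= !ad_cons mulrA -IH //.
Qed.

Lemma ad_end q : okpath q -> P (path_end q) * ad q = ad q.
Proof. by move=> h; rewrite -(ad_nil (path_end q)) -ad_cat // catp_nil. Qed.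

Lemma ad_mn q : okpath q -> ad q * mn q = P (path_end q).
Proof.
case: q => v s; elim: s v => [|e s IH] v /=; first by rewrite ad_nil mn_nil famPP.
rewrite {1}/okpath /= => /andP[/eqP <- h]; rewrite ad_cons mn_cons mulrA -(mulrA _ (Y e)) famYX.
by rewrite (ad_P (rng e, s)) IH.
Qed.

Lemma ad_mn0 q q' : okpath q -> okpath q' -> plen q = plen q' -> q <> q' -> ad q * mn q' = 0.
Proof.
case: q q' => v s [v' s']; elim: s v v' s' => [|e s IH] v v' [|e' s'] //=.
  move=> _ _ _ h; rewrite ad_nil mn_nil famPP0 //; by apply/eqP => e; apply: h; rewrite e.
rewrite {1 2}/okpath /= => /andP[/eqP <- h] /andP[/eqP <- h'] [hs] hn; rewrite ad_cons mn_cons mulrA -(mulrA _ (Y e)).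
have [ee|ne] := eqVneq e e'; last by rewrite famYX0 // mulr0 mul0r.
subst e'; rewrite famYX (ad_P (rng e, s)); apply: IH => // -[hss]; apply: hn; by rewrite hss.
Qed.

Lemma sum_paths_from (hG : nosink G) w k : \sum_(p <- paths_from w k) mn (w, p) * ad (w, p) = P w.
Proof.
elim: k w => [|k IH] w; first by rewrite /= big_seq1 mn_nil ad_nil famPP.
rewrite /= big_flatten big_map big_filter famP // big_enum_cond /=.
apply: eq_big => [e|e /eqP <-]; first by [].
rewrite big_map -[in RHS](famXP e) -(IH (rng e)) mulr_sumr mulr_suml.
by apply: eq_bigr => p _; rewrite mn_cons ad_cons !mulrA.
Qed.

Lemma sum_ext (hG : nosink G) q k : okpath q ->
  \sum_(p <- paths_from (path_end q) k) mn (catp q p) * ad (catp q p) = mn q * ad q.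
Proof.
move=> hq; rewrite -[in RHS](mn_end hq) -(sum_paths_from hG (path_end q) k) mulr_sumr mulr_suml.
by apply: eq_bigr => p _; rewrite mn_cat // ad_cat // !mulrA.
Qed.

Lemma sum_paths_of_len (hG : nosink G) k : \sum_(q <- paths_of_len G k) mn q * ad q = 1.
Proof.
rewrite /paths_of_len big_allpairs_dep -fam1 big_enum /=.
by apply: eq_bigr => v _; exact: sum_paths_from.
Qed.

Lemma mn_st (hst : lpa_star S iB st P X Y) q : okpath q -> st (mn q) = ad q.
Proof.
case: hst => _ [hM [_ [_ [hP hX]]]].
case: q => v s; elim: s v => [|e s IH] v /=; first by rewrite mn_nil ad_nil.
rewrite {1}/okpath /= => /andP[/eqP <- h]; rewrite ad_cons mn_cons hM IH // hX //.
Qed.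

Lemma ext_by_long (hG : nosink G) b b' k :
  (forall q, okpath q -> plen q = k -> b * mn q = b' * mn q) -> b = b'.
Proof.
move=> h; rewrite -(mulr1 b) -(mulr1 b') -(sum_paths_of_len hG k) !mulr_sumr.
rewrite big_seq [RHS]big_seq; apply: eq_bigr => q; rewrite mem_paths_of_len => /andP[h1 /eqP h2].
by rewrite !mulrA h.
Qed.

(** A product of b with a path longer than all ghost parts of b contains no ghost edges any more.
    The bound m keeps enough length for a further factor to act. *)
Definition spans (m : nat) (r : gV G) (x : B) :=
  exists s : seq (cplx * vpath G),
    (forall z, z \in s -> [/\ S z.1, okpath z.2, path_end z.2 = r & (m <= plen z.2)%N]) /\
    x = \sum_(z <- s) iB z.1 * mn z.2.

(** The additive maps [pi] encode the independence of different degrees. *)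
Definition grading (H : int -> B -> Prop) :=
  [/\ forall k, H k 0,
      (forall k a b, H k a -> H k b -> H k (a + b)),
      (forall j k a b, H j a -> H k b -> H (j + k) (a * b)),
      (forall c, S c -> H 0 (iB c)) &
      exists pi : int -> B -> B, (forall k a b, pi k (a + b) = pi k a + pi k b) /\
        forall j k b, H k b -> pi j b = if j == k then b else 0].

(* What is used of a Leavitt path algebra. All of it survives an isomorphism and the passage to the
   line graph, so several graphs can present the same ring B. H k is the degree k part. *)
Record leavitt_pres (H : int -> B -> Prop) : Prop := Pres {
  pr_alg : ralg S iB ;
  pr_fam : unital_leavitt_family P X Y ;
  pr_star : lpa_star S iB st P X Y ;
  pr_tors : forall c v, S c -> iB c * P v = 0 -> c = 0 ;
  pr_gen : forall b, exists L, forall q, okpath q -> (L <= plen q)%N -> spans 0 (path_end q) (b * mn q) ;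
  pr_grad : grading H ;
  pr_P : forall v, H 0 (P v) ;
  pr_X : forall e, H 1 (X e) ;
  pr_Y : forall e, H (-1) (Y e) }.

(* The diagonal, see [level_diag]. *)
Definition level (b : B) :=
  exists L, forall q, okpath q -> (L <= plen q)%N -> exists2 c, S c & b * mn q = iB c * mn q.
End Family.

(** * The length grading of a Leavitt path algebra *)

Section Grading.
Variables (S : cplx -> Prop) (hS : conj_closed_unital_subring S) (G : lgraph).
Variables (A : pzRingType) (iA : cplx -> A) (stA : A -> A).
Variables (P : gV G -> A) (X Y : gE G -> A).
Variable (hral : ralg S iA).

(* Extended by 0 outside S, where the [iA c] need not commute. *)
Definition graded_act (c : cplx) (f : int -> A) : int -> A :=
  fun j => if `[<S c>] then iA c * f j else 0.

Lemma graded_act_add c : {morph graded_act c : x y / x + y}.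
Proof.
move=> f g; apply: funext => j; rewrite /graded_act.
by rewrite !fctE; case: ifP => _; rewrite ?mulrDr ?addr0.
Qed.

Lemma graded_act_comm c d f : graded_act c (graded_act d f) = graded_act d (graded_act c f).
Proof.
apply: funext => j; rewrite /graded_act.
case: ifP => [/asboolP hc|_]; case: ifP => [/asboolP hd|_]; rewrite ?mulr0 //.
by rewrite !mulrA (ralgZ hral).
Qed.

Definition graded_scal := ScalAct graded_act_add graded_act_comm.

(** Multiplication by a t^k on sequences in A indexed by Z. The endomorphisms of this module take
    the place of the Laurent polynomial ring A[t,1/t]. *)
Definition graded_op (a : A) (k : int) : endo graded_scal.
Proof.
exists (fun f j => a * f (j - k)) => [f g|c f]; apply: funext => j.
  by rewrite !fctE mulrDr.
rewrite /= /graded_act; case: ifP => [/asboolP hc|_]; last by rewrite mulr0.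
by rewrite !mulrA (ralgZ hral).
Defined.

Lemma graded_opM a b j k : graded_op a j * graded_op b k = graded_op (a * b) (j + k).
Proof.
apply: endo_ext => f; apply: funext => i /=.
by rewrite mulrA; congr (_ * f _); rewrite opprD addrA.
Qed.
Lemma graded_opD a b j : graded_op a j + graded_op b j = graded_op (a + b) j.
Proof. by apply: endo_ext => f; apply: funext => i /=; rewrite fctE mulrDl. Qed.
Lemma graded_op0 j : graded_op 0 j = 0.
Proof. by apply: endo_ext => f; apply: funext => i /=; rewrite mul0r. Qed.
Lemma graded_op1 : graded_op 1 0 = 1.
Proof. by apply: endo_ext => f; apply: funext => i /=; rewrite mul1r subr0. Qed.
Lemma graded_op_sum (I : finType) (p : pred I) (F : I -> A) j :
  \sum_(i | p i) graded_op (F i) j = graded_op (\sum_(i | p i) F i) j.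
Proof. by elim/big_rec2: _ => [|i x y _ ->]; rewrite ?graded_op0 ?graded_opD. Qed.
Lemma graded_op_scal c : S c -> endo_act graded_scal c = graded_op (iA c) 0.
Proof.
move=> hc; apply: endo_ext => f; apply: funext => i /=; rewrite /graded_act.
by move/asboolP: hc => ->; rewrite subr0.
Qed.

Lemma graded_ralg : ralg S (endo_act graded_scal).
Proof.
split=> [|a b ha hb|a b ha hb|a x ha].
- by rewrite graded_op_scal ?(ralg1 hral) ?graded_op1 //; exact: scal1 hS.
- by rewrite !graded_op_scal ?graded_opD ?(ralgD hral) //; exact: scalD hS _ _ ha hb.
- by rewrite !graded_op_scal ?graded_opM ?(ralgM hral) ?addr0 //; exact: scalM hS _ _ ha hb.
- by apply: endo_ext => f /=; rewrite endoZ.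
Qed.

Lemma graded_family : unital_leavitt_family P X Y ->
  unital_leavitt_family (fun v => graded_op (P v) 0) (fun e => graded_op (X e) 1) (fun e => graded_op (Y e) (-1)).
Proof.
move=> hF; split; last by rewrite graded_op_sum (fam1 hF) graded_op1.
split; first by move=> v; rewrite graded_opM (famPP hF).
split; first by move=> v w h; rewrite graded_opM (famPP0 hF) // graded_op0.
split; first by move=> e f h; rewrite graded_opM (famYX0 hF) // graded_op0.
split; first by move=> e; rewrite graded_opM (famYX hF) addNr.
split; first by move=> e; rewrite !graded_opM (famPX hF) (famXP hF).
split; first by move=> e; rewrite !graded_opM (famYP hF) (famPY hF).
move=> v hv; rewrite (famP hF hv) -graded_op_sum; apply: eq_bigr => e _.
by rewrite graded_opM addrN.
Qed.

(** The universal property applied to the family v, e t, e^* t^-1 gives a coaction [D]; degree k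
    consists of those b with D b = b t^k. *)
Lemma lpa_grading : is_LPA S iA stA P X Y -> exists H : int -> A -> Prop,
  [/\ grading S iA H, forall v, H 0 (P v), forall e, H 1 (X e) & forall e, H (-1) (Y e)].
Proof.
case=> _ hF _ hU.
have [D [[DD DM D1 DZ] DP DX DY _]] := hU _ _ _ _ _ graded_ralg (graded_family hF).
have D0 : D 0 = 0 by apply: (@addrI _ (D 0)); rewrite -DD !addr0.
exists (fun k b => D b = graded_op b k); split=> //.
split.
- by move=> k; rewrite D0 graded_op0.
- by move=> k a b ha hb; rewrite DD ha hb graded_opD.
- by move=> j k a b ha hb; rewrite DM ha hb graded_opM.
- by move=> c hc; rewrite -[iA c]mulr1 DZ // D1 !mulr1 graded_op_scal.
(* Applied to the sequence concentrated at 0, b t^k gives b at place k and 0 elsewhere; reading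
   place j is the projection to degree j. *)
exists (fun j b => D b (fun i => if i == 0 then 1 else 0) j); split.
  by move=> k a b; rewrite DD.
move=> j k b -> /=; rewrite subr_eq0.
by case: eqP => _; rewrite ?mulr1 ?mulr0.
Qed.
End Grading.

(** * Torsion-freeness from the action on infinite paths *)

Section InfinitePaths.
Variables (S : cplx -> Prop) (hS : conj_closed_unital_subring S) (G : lgraph) (hG : nosink G).

Record ipath := IPath { ip :> nat -> gE G ; ipP : forall i, rng (ip i) = src (ip i.+1) }.

Lemma ipath_ext (x y : ipath) : (forall i, x i = y i) -> x = y.
Proof.
case: x y => [x hx] [y hy] /= h; have e : x = y by exact: funext.
by subst y; congr IPath; exact: Prop_irrelevance.
Qed.

Definition ishift (x : ipath) : ipath := IPath (fun i => ipP x i.+1).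

Definition icons_fun (e : gE G) (x : ipath) (i : nat) := if i is j.+1 then x j else e.

Lemma icons_subproof e (x : ipath) : rng e = src (x 0%N) ->
  forall i, rng (icons_fun e x i) = src (icons_fun e x i.+1).
Proof. by move=> h [|i] //=; exact: ipP. Qed.

Definition icons e (x : ipath) (h : rng e = src (x 0%N)) : ipath := IPath (icons_subproof h).

Lemma ipath_from v : exists x : ipath, src (x 0%N) = v.
Proof.
have [nxt hn] := choice hG.
pose w i := iter i (fun u => rng (nxt u)) v.
have hw i : rng (nxt (w i)) = src (nxt (w i.+1)) by rewrite hn.
by exists (IPath hw); rewrite /= hn.
Qed.

Definition ipath_act (c : cplx) (f : ipath -> cplx) : ipath -> cplx := fun x => c * f x.
Lemma ipath_act_add c : {morph ipath_act c : x y / x + y}.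
Proof. by move=> f g; apply: funext => x; rewrite /ipath_act !fctE mulrDr. Qed.
Lemma ipath_act_comm c d f : ipath_act c (ipath_act d f) = ipath_act d (ipath_act c f).
Proof. by apply: funext => x; rewrite /ipath_act mulrCA. Qed.
Definition ipath_scal := ScalAct ipath_act_add ipath_act_comm.

Definition ipP_op (v : gV G) : endo ipath_scal.
Proof.
exists (fun (f : ipath -> cplx) (x : ipath) => if src (x 0%N) == v then f x else 0) => [f g|c f]; apply: funext => x.
  by rewrite !fctE; case: ifP; rewrite ?addr0.
by rewrite /= /ipath_act; case: ifP; rewrite ?mulr0.
Defined.

Definition ipX_op (e : gE G) : endo ipath_scal.
Proof.
exists (fun (f : ipath -> cplx) (x : ipath) => if x 0%N == e then f (ishift x) else 0) => [f g|c f]; apply: funext => x.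
  by rewrite !fctE; case: ifP; rewrite ?addr0.
by rewrite /= /ipath_act; case: ifP; rewrite ?mulr0.
Defined.

(** Adjoint to [ipX_op]: f is evaluated at e x. The match on [eqVneq] keeps the proof of
    composability that [icons] takes. *)
Definition ipY_op (e : gE G) : endo ipath_scal.
Proof.
exists (fun (f : ipath -> cplx) (x : ipath) => match eqVneq (rng e) (src (x 0%N)) with
                   | EqNotNeq h => f (icons h) | _ => 0 end) => [f g|c f]; apply: funext => x.
  by rewrite !fctE; case: eqVneq; rewrite ?addr0.
by rewrite /= /ipath_act; case: eqVneq; rewrite ?mulr0.
Defined.

Lemma ipath_ralg : ralg S (endo_act ipath_scal).
Proof.
split=> [|a b ha hb|a b ha hb|a x ha]; apply: endo_ext => f.
- by apply: funext => x /=; rewrite /ipath_act mul1r.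
- by apply: funext => x /=; rewrite fctE /ipath_act -mulrDl.
- by apply: funext => x /=; rewrite /ipath_act -mulrA.
- by rewrite /= endoZ.
Qed.

Lemma ipath_family : unital_leavitt_family ipP_op ipX_op ipY_op.
Proof.
have fsum (I : finType) (p : pred I) (F : I -> ipath -> cplx) x :
    (\sum_(i | p i) F i) x = \sum_(i | p i) F i x.
  by elim/big_rec2: _ => // i y z _ <-.
split; last first.
  apply: endo_ext => f; apply: funext => x; rewrite endo_sumE fsum /=.
  by rewrite (bigD1 (src (x 0%N))) //= eqxx big1 ?addr0 // => v /negbTE; rewrite eq_sym => ->.
split; [|split; [|split; [|split; [|split; [|split]]]]].
- by move=> v; apply: endo_ext => f; apply: funext => x /=; case: (_ == v).
- move=> v w /negbTE h; apply: endo_ext => f; apply: funext => x /=.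
  by case: eqP => // ->; rewrite h.
- move=> e f /negbTE h; apply: endo_ext => g; apply: funext => x /=.
  by case: eqVneq => //= ?; rewrite h.
- move=> e; apply: endo_ext => g; apply: funext => x /=.
  by case: eqVneq => [h|h] //=; rewrite eqxx; congr (g _); apply: ipath_ext => i.
- move=> e; split; apply: endo_ext => g; apply: funext => x /=.
    by case: (eqVneq (x 0%N) e) => [->|]; rewrite ?eqxx // if_same.
  by case: (eqVneq (x 0%N) e) => [<-|] //; rewrite -ipP eqxx.
- move=> e; split; apply: endo_ext => g; apply: funext => x /=.
    by case: (eqVneq (rng e) (src (x 0%N))) => //= h; rewrite eqxx.
  by case: (eqVneq (rng e) (src (x 0%N))).
- move=> v _; apply: endo_ext => g; apply: funext => x; rewrite endo_sumE fsum /=.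
  case: ifP => [h|/negbT h]; last first.
    by rewrite big1 // => e /eqP he; case: eqP => // hx; rewrite hx he eqxx in h.
  rewrite (bigD1 (x 0%N)) //= eqxx big1 ?addr0 => [|e /andP[_ /negbTE]]; last by rewrite eq_sym => ->.
  case: eqVneq => [h'|]; last by rewrite -ipP eqxx.
  by congr (g _); apply: ipath_ext => -[|i].
Qed.

(** In the representation on functions of infinite paths, c v sends the constant function 1 to a
    function with value c at any path starting at v. *)
Lemma lpa_torsion (A : pzRingType) (iA : cplx -> A) stA (P : gV G -> A) (X Y : gE G -> A) :
  is_LPA S iA stA P X Y -> forall c v, S c -> iA c * P v = 0 -> c = 0.
Proof.
case=> _ _ _ hU c v hc h0.
have [D [[DD DM D1 DZ] DP _ _ _]] := hU _ _ _ _ _ ipath_ralg ipath_family.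
have D0 : D 0 = 0 by apply: (@addrI _ (D 0)); rewrite -DD !addr0.
have [x hx] := ipath_from v.
have := congr1 (fun f : endo ipath_scal => f (fun=> 1) x) (DZ c (P v) hc).
by rewrite h0 D0 DP /= /ipath_act hx eqxx mulr1 => <-.
Qed.
End InfinitePaths.

Section Spans.
Variables (S : cplx -> Prop) (hS : conj_closed_unital_subring S) (G : lgraph).
Variables (A : pzRingType) (iA : cplx -> A) (stA : A -> A).
Variables (P : gV G -> A) (X Y : gE G -> A).
Hypothesis (hral : ralg S iA) (hF : unital_leavitt_family P X Y).

Local Notation spans := (spans S iA P X).

Lemma spans0 m r : spans m r 0.
Proof. by exists [::]; split=> //; rewrite big_nil. Qed.

Lemma spans_mn m q c : S c -> okpath q -> (m <= plen q)%N -> spans m (path_end q) (iA c * mn P X q).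
Proof.
move=> hc hq hm; exists [:: (c, q)]; split; last by rewrite big_seq1.
by move=> z; rewrite inE => /eqP ->.
Qed.

Lemma spans_mn1 m q : okpath q -> (m <= plen q)%N -> spans m (path_end q) (mn P X q).
Proof.
move=> hq hm; rewrite -[mn P X q]mul1r -(ralg1 hral); apply: spans_mn => //; exact: scal1 hS.
Qed.

Lemma spansD m r x y : spans m r x -> spans m r y -> spans m r (x + y).
Proof.
move=> [s [hs ->]] [s' [hs' ->]]; exists (s ++ s'); split; last by rewrite big_cat.
by move=> z; rewrite mem_cat => /orP[/hs|/hs'].
Qed.

Lemma spansZ m r c x : S c -> spans m r x -> spans m r (iA c * x).
Proof.
move=> hc [s [hs ->]]; exists [seq (c * z.1, z.2) | z <- s]; split.
  by move=> _ /mapP[z zs ->] /=; case: (hs z zs) => h1 h2 h3 h4; split=> //; exact: scalM hS _ _ hc h1.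
rewrite big_map mulr_sumr big_seq [RHS]big_seq; apply: eq_bigr => z zs.
by case: (hs z zs) => h1 _ _ _; rewrite mulrA (ralgM hral).
Qed.

Lemma spansW m m' r x : (m' <= m)%N -> spans m r x -> spans m' r x.
Proof.
move=> h [s [hs ->]]; exists s; split=> // z /hs[h1 h2 h3 h4]; split=> //; exact: leq_trans h4.
Qed.

Lemma spans_mul m m' r b x : spans m r x ->
  (forall q, okpath q -> (m <= plen q)%N -> path_end q = r -> spans m' r (b * mn P X q)) ->
  spans m' r (b * x).
Proof.
move=> [s [hs ->]] hb; elim: s hs => [|z s IH] hs; first by rewrite big_nil mulr0; exact: spans0.
rewrite big_cons mulrDr; apply: spansD; last first.
  by apply: IH => y ys; apply: hs; rewrite inE ys orbT.
have [h1 h2 h3 h4] := hs z (mem_head _ _).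
by rewrite mulrA -(ralgZ hral) // -mulrA; apply: spansZ => //; exact: hb.
Qed.

Lemma spans_mn_uniq m r x : spans m r x -> exists (l : seq (vpath G)) (c : vpath G -> cplx),
  [/\ uniq l, forall a, S (c a), forall a, a \in l -> [/\ okpath a, path_end a = r & (m <= plen a)%N] &
      x = \sum_(a <- l) iA (c a) * mn P X a].
Proof.
move=> [s [hs ->]]; elim: s hs => [|z s IH] hs.
  by exists [::], (fun=> 0); split=> // [_|]; [exact: scal0 hS | rewrite !big_nil].
have [|l [c [ul Sc hl e]]] := IH; first by move=> y ys; apply: hs; rewrite inE ys orbT.
have [h1 h2 h3 h4] := hs z (mem_head _ _).
rewrite big_cons e; have [zl|zl] := boolP (z.2 \in l).
- exists l, (fun a => if a == z.2 then z.1 + c a else c a); split=> //.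
    by move=> a; case: ifP => _ //; exact: scalD hS _ _ h1 (Sc a).
  rewrite !(bigD1_seq z.2) //= eqxx addrA; congr (_ + _).
    by rewrite (ralgD hral) // mulrDl.
  by apply: eq_bigr => a /negbTE ->.
- exists (z.2 :: l), (fun a => if a == z.2 then z.1 else c a); split=> //=.
  + by rewrite zl.
  + by move=> a; case: ifP.
  + by move=> a; rewrite inE => /orP[/eqP ->|/hl].
  rewrite big_cons eqxx; congr (_ + _); rewrite big_seq [RHS]big_seq; apply: eq_bigr => a al.
  by case: eqP => // h; rewrite -h al in zl.
Qed.
End Spans.

Section Generation.
Variables (S : cplx -> Prop) (hS : conj_closed_unital_subring S) (G : lgraph).
Variables (A : pzRingType) (iA : cplx -> A) (stA : A -> A).
Variables (P : gV G -> A) (X Y : gE G -> A) (hA : is_LPA S iA stA P X Y).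

Local Notation spans := (spans S iA P X).
Let hral : ralg S iA. Proof. by case: hA. Qed.
Let hF : unital_leavitt_family P X Y. Proof. by case: hA. Qed.

(** The form [plen q - L], saying that b shortens paths by at most L, is what makes the claim stable
    under products. *)
Lemma lpa_gen b : exists L, forall q, okpath q -> (L <= plen q)%N ->
  spans (plen q - L) (path_end q) (b * mn P X q).
Proof.
move: b; apply: (lpa_ind hS hA).
- move=> x y [L1 h1] [L2 h2]; exists (maxn L1 L2) => q hq hL.
  rewrite mulrBl -[- _]mul1r -(ralg1 hral) mulrN -mulNr -(ralgN hS hral); last exact: scal1 hS.
  apply: spansD; last apply: (spansZ hS hral).
  + by apply: spansW (h1 q hq _); lia.
  + exact: scalN hS _ (scal1 hS).
  + by apply: spansW (h2 q hq _); lia.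
(* After y at least L1 edges remain, enough for x to act. *)
- move=> x y [L1 h1] [L2 h2]; exists (L1 + L2)%N => q hq hL; rewrite -mulrA.
  apply: (spans_mul hS hral) (h2 q hq _) _; first by lia.
  move=> a ha hm <-; apply: spansW (h1 a ha _); lia.
- move=> c hc; exists 0%N => q hq _; apply: spans_mn => //; lia.
- move=> v; exists 0%N => q hq _; have [e|h] := eqVneq v q.1; last first.
    by rewrite (P_mn0 hF) //; exact: spans0.
  by rewrite e (P_mn hF); apply: (spans_mn1 hS _ _ hral) => //; lia.
- move=> e; exists 0%N => -[w p] hq _; have [h|h] := eqVneq (rng e) w; last first.
    by rewrite -(famXP hF) -mulrA (P_mn0 hF) ?mulr0 //; exact: spans0.
  subst w; rewrite -(mn_cons hF); apply: (spans_mn1 hS _ _ hral (q := (src e, e :: p))).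
    by rewrite /okpath /= eqxx.
  by rewrite /plen /=; lia.
- move=> e; exists 1%N => -[w [|f p]] // /andP[/= /eqP <- hq] _.
  rewrite (mn_cons hF) mulrA; have [h|h] := eqVneq e f; last first.
    by rewrite (famYX0 hF) ?mul0r //; exact: spans0.
  subst f; rewrite (famYX hF) (P_mn hF (rng e, p)).
  by apply: (spans_mn1 hS _ _ hral (q := (rng e, p))) => //; rewrite /plen /=; lia.
Qed.

Lemma lpa_leavitt_pres (hG : nosink G) : exists H, leavitt_pres S iA stA P X Y H.
Proof.
have [H [h1 h2 h3 h4]] := lpa_grading hS hral hA.
exists H; split=> //.
- by case: hA.
- exact: lpa_torsion hG _ _ _ _ _ _ hA.
- move=> b; have [L h] := lpa_gen b; exists L => q hq hL; apply: spansW (h q hq hL); lia.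
Qed.
End Generation.

Section Transport.
Variables (S : cplx -> Prop) (hS : conj_closed_unital_subring S) (G : lgraph).
Variables (A B : pzRingType) (iA : cplx -> A) (iB : cplx -> B) (stA : A -> A) (stB : B -> B).
Variables (P : gV G -> A) (X Y : gE G -> A) (H : int -> A -> Prop).
Variables (phi : A -> B) (psi : B -> A).
Hypothesis phiK : cancel phi psi.
Hypothesis psiK : cancel psi phi.
Hypothesis phiD : forall x y, phi (x + y) = phi x + phi y.
Hypothesis phiM : forall x y, phi (x * y) = phi x * phi y.
Hypothesis phiZ : forall a x, S a -> phi (iA a * x) = iB a * phi x.
Hypothesis phi_st : forall x, phi (stA x) = stB (phi x).
Hypothesis hB : ralg S iB.

Lemma phi1 : phi 1 = 1.
Proof. by rewrite -[LHS]mul1r -{1}(psiK 1) -phiM mulr1 psiK. Qed.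
Lemma phi0 : phi 0 = 0.
Proof. by apply: (@addrI _ (phi 0)); rewrite -phiD !addr0. Qed.
Lemma phi_scal a : S a -> phi (iA a) = iB a.
Proof. by move=> ha; rewrite -[iA a]mulr1 phiZ // phi1 mulr1. Qed.
Lemma phi_sum (I : Type) (s : seq I) (p : pred I) (F : I -> A) :
  phi (\sum_(i <- s | p i) F i) = \sum_(i <- s | p i) phi (F i).
Proof. exact: (big_morph phi phiD phi0). Qed.
Lemma psiD x y : psi (x + y) = psi x + psi y.
Proof. by rewrite -{1}(psiK x) -{1}(psiK y) -phiD phiK. Qed.
Lemma psiM x y : psi (x * y) = psi x * psi y.
Proof. by rewrite -{1}(psiK x) -{1}(psiK y) -phiM phiK. Qed.

Lemma phi_mn q : phi (mn P X q) = mn (phi \o P) (phi \o X) q.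
Proof. by rewrite !mnE /path_mono phiM (big_morph phi phiM phi1). Qed.
Lemma phi_ad q : phi (ad P Y q) = ad (phi \o P) (phi \o Y) q.
Proof. by rewrite !adE /path_adj phiM (big_morph phi phiM phi1). Qed.

Lemma transport_leavitt_pres : leavitt_pres S iA stA P X Y H ->
  leavitt_pres S iB stB (phi \o P) (phi \o X) (phi \o Y) (fun k b => H k (psi b)).
Proof.
case=> hral hF hst htor hgen [g1 g2 g3 g4 [pi [pD pE]]] hP hX hY; split=> //.
- split; last by rewrite /= -phi_sum (fam1 hF) phi1.
  split; [|split; [|split; [|split; [|split; [|split]]]]] => /=.
  + by move=> v; rewrite -phiM (famPP hF).
  + by move=> v w h; rewrite -phiM (famPP0 hF) // phi0.
  + by move=> v w h; rewrite -phiM (famYX0 hF) // phi0.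
  + by move=> e; rewrite -phiM (famYX hF).
  + by move=> e; rewrite -!phiM (famPX hF) (famXP hF).
  + by move=> e; rewrite -!phiM (famYP hF) (famPY hF).
  + by move=> v hv; rewrite (famP hF hv) phi_sum; apply: eq_bigr => e _; rewrite phiM.
- case: hst => s1 [s2 [s3 [s4 [s5 s6]]]].
  split; [|split; [|split; [|split; [|split]]]].
  + by move=> x y; rewrite -(psiK x) -(psiK y) -phiD -!phi_st s1 phiD.
  + by move=> x y; rewrite -(psiK x) -(psiK y) -phiM -!phi_st s2 phiM.
  + by move=> x; rewrite -(psiK x) -!phi_st s3.
  + by move=> a ha; rewrite -phi_scal // -phi_st s4 // phi_scal //; exact: scalC hS _ ha.
  + by move=> v; rewrite /= -phi_st s5.
  + by move=> e; rewrite /= -phi_st s6.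
- by move=> c v hc; rewrite /= -phiZ // -phi0 => /(can_inj phiK) /htor; apply.
- move=> b; have [L h] := hgen (psi b); exists L => q hq hL.
  have [s [h1 h2]] := h q hq hL; exists s; split=> //.
  rewrite -phi_mn -{1}(psiK b) -phiM h2 phi_sum big_seq [RHS]big_seq; apply: eq_bigr => z zs.
  by rewrite -phi_mn phiZ //; case: (h1 z zs).
- split.
  + by move=> k; rewrite -phi0 phiK.
  + by move=> k a b ha hb; rewrite psiD; exact: g2.
  + by move=> j k a b ha hb; rewrite psiM; exact: g3.
  + by move=> c hc; rewrite -phi_scal // phiK; exact: g4.
  exists (fun k b => phi (pi k (psi b))); split.
    by move=> k a b; rewrite psiD pD phiD.
  move=> j k b hb; rewrite (pE _ _ _ hb); by case: eqP => _; rewrite ?psiK ?phi0.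
- by move=> v /=; rewrite phiK.
- by move=> v /=; rewrite phiK.
- by move=> v /=; rewrite phiK.
Qed.
End Transport.

(** * The diagonal and its normalizers *)

Section ConditionL.
Variable G : lgraph.

Lemma gend_take (v : gV G) p e0 i : gpath v p -> (i < size p)%N ->
  gend v (take i p) = src (nth e0 p i).
Proof.
move=> hp hi; move: hp; rewrite -{1}(cat_take_drop i p) gpath_cat => /andP[_].
by rewrite (drop_nth e0 hi) /= => /andP[/eqP].
Qed.

(** A repeated source vertex encloses a shorter closed path, whence induction on the length. *)
Lemma closed_path_has_cycle (v : gV G) p : gpath v p -> p != [::] -> gend v p = v ->
  exists2 u : seq (gE G), is_cycle u & {subset u <= p}.
Proof.
have [k] := ubnP (size p); elim: k v p => // k IH v p hk hp hn hc.
have [us|] := boolP (uniq (map (@src G) p)); first by exists p => //; exists v.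
case: p hk hp hn hc => // e0 p0; set p := e0 :: p0 => hk hp _ hc.
move/(uniqPn v) => [i [j [ij hj]]]; rewrite size_map in hj.
rewrite !(nth_map e0) ?(ltn_trans ij) // => hs.
have hi : (i < size p)%N by exact: ltn_trans hj.
pose u := take (j - i) (drop i p).
have ej : take i p ++ u = take j p by rewrite /u -takeD subnKC // ltnW.
have su : size u = (j - i)%N by rewrite /u size_takel // size_drop; lia.
have hu : gpath (gend v (take i p)) u.
  have : gpath v (take i p ++ u).
    by rewrite ej; move: hp; rewrite -{1}(cat_take_drop j p) gpath_cat => /andP[].
  by rewrite gpath_cat => /andP[].
have [||||w hw wu] := IH (gend v (take i p)) u.
- by rewrite su; lia.
- exact: hu.
- by rewrite -size_eq0 su; lia.
- by rewrite -gend_cat ej !(gend_take e0) // hs.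
- by exists w => // e /wu; rewrite /u => /mem_take /mem_drop.
Qed.

(** A cycle inside p has an exit. Follow p up to the edge with the exit, leave there, and continue
    arbitrarily to the length of p. *)
Lemma branching_of_conditionL : essential G -> condition_L G -> branching G.
Proof.
move=> hess hL.
have hns : nosink G.
  move=> v; apply: contrapT => hv; case: (hess v) => [] hs _; apply: hs => e.
  by apply/eqP => he; apply: hv; exists e.
split=> // v p hp hn hc.
have [u /hL [f [e eu [sf fe]]] up] := closed_path_has_cycle hp hn hc.
move: (up _ eu) hp => /splitPr [p1 p2]; rewrite gpath_cat /= => /and3P[h1 /eqP h2 h3].
have [r] := paths_from_nonnil hns (rng f) (size p2); rewrite mem_paths_from => /andP[hr /eqP sr].
exists (p1 ++ f :: r); first by rewrite gpath_cat h1 /= sf h2 eqxx.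
split; first by rewrite !size_cat /= sr.
by move/eqP; rewrite eqseq_cat // eqxx /= => /eqP[/eqP]; rewrite (negbTE fe).
Qed.
End ConditionL.

Section GradingTheory.
Variables (S : cplx -> Prop) (B : pzRingType) (iB : cplx -> B) (H : int -> B -> Prop).
Hypothesis hgr : grading S iB H.

Lemma grading0 k : H k 0. Proof. by case: hgr. Qed.
Lemma gradingD k a b : H k a -> H k b -> H k (a + b).
Proof. by case: hgr => _ h _ _ _; exact: h. Qed.
Lemma gradingM j k a b : H j a -> H k b -> H (j + k) (a * b).
Proof. by case: hgr => _ _ h _ _; exact: h. Qed.
Lemma gradingS c : S c -> H 0 (iB c). Proof. by case: hgr => _ _ _ h _; exact: h. Qed.
Lemma gradingZ k c a : S c -> H k a -> H k (iB c * a).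
Proof. by move=> hc ha; rewrite -[k]add0r; apply: gradingM => //; exact: gradingS. Qed.
Lemma grading_uniq j k a : H j a -> H k a -> a <> 0 -> j = k.
Proof.
case: hgr => _ _ _ _ [pi [_ hpi]] ha hb a0; apply/eqP; apply: contrapT => /negP njk.
by apply: a0; move: (hpi j j a ha); rewrite (hpi j k a hb) eqxx (negbTE njk).
Qed.
End GradingTheory.

Section Presentation.
Variables (S : cplx -> Prop) (hS : conj_closed_unital_subring S) (G : lgraph).
Variables (B : pzRingType) (iB : cplx -> B) (st : B -> B).
Variables (P : gV G -> B) (X Y : gE G -> B) (H : int -> B -> Prop).
Hypothesis (hp : leavitt_pres S iB st P X Y H).

Local Notation mn := (mn P X).
Local Notation ad := (ad P Y).
Local Notation level := (level S iB P X).
Local Notation spans := (spans S iB P X).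

Let hral := pr_alg hp.
Let hF := pr_fam hp.
Let hgr := pr_grad hp.

Lemma H_mn q : okpath q -> H (plen q)%:Z (mn q).
Proof.
case: q => v p; elim: p v => [|e p IH] v; first by rewrite mn_nil => _; exact: (pr_P hp v).
rewrite {1}/okpath /= => /andP[/eqP <- h]; rewrite (mn_cons hF).
have -> : (plen (src e, e :: p))%:Z = 1 + (plen (rng e, p))%:Z by rewrite /plen /=; lia.
by apply: (gradingM hgr); [exact: pr_X hp e | exact: IH].
Qed.

Lemma H_ad q : okpath q -> H (- (plen q)%:Z) (ad q).
Proof.
case: q => v p; elim: p v => [|e p IH] v; first by rewrite ad_nil => _; exact: (pr_P hp v).
rewrite {1}/okpath /= => /andP[/eqP <- h]; rewrite (ad_cons hF).
have -> : - (plen (src e, e :: p))%:Z = - (plen (rng e, p))%:Z + - 1 by rewrite /plen /=; lia.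
by apply: (gradingM hgr); [exact: IH | exact: pr_Y hp e].
Qed.

Lemma split_path (q : vpath G) n : okpath q -> (n <= plen q)%N ->
  exists q1 p, [/\ q = catp q1 p, okpath q1, plen q1 = n & gpath (path_end q1) p].
Proof.
case: q => v p hq hn; exists (v, take n p), (drop n p).
move: hq; rewrite /okpath /= -{1}(cat_take_drop n p) gpath_cat => /andP[h1 h2].
by split; rewrite /catp /plen /= ?cat_take_drop // size_takel.
Qed.

Lemma proj_mn q0 q : okpath q0 -> okpath q -> (plen q0 <= plen q)%N ->
  mn q0 * ad q0 * mn q = mn q \/ mn q0 * ad q0 * mn q = 0.
Proof.
move=> h0 hq hl; have [q1 [p [-> h1 h2 h3]]] := split_path hq hl.
rewrite (mn_cat hF) // mulrA -(mulrA _ (ad q0)).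
have [e|ne] := EM (q0 = q1); [left; subst q1 | right].
  by rewrite (ad_mn hF) // (mn_end hF).
by rewrite (ad_mn0 hF) // mulr0 mul0r.
Qed.

Lemma level_proj q0 : okpath q0 -> level (mn q0 * ad q0).
Proof.
move=> h0; exists (plen q0) => q hq hl; case: (proj_mn h0 hq hl) => ->.
  by exists 1; [exact: scal1 hS | rewrite (ralg1 hral) mul1r].
by exists 0; [exact: scal0 hS | rewrite (ralg0 hS hral) mul0r].
Qed.

Lemma level_scal c : S c -> level (iB c).
Proof. by move=> hc; exists 0%N => q _ _; exists c. Qed.

Lemma levelD d d' : level d -> level d' -> level (d + d').
Proof.
move=> [L h] [L' h']; exists (maxn L L') => q hq hL.
have [|c Sc e] := h q hq; first by lia.
have [|c' Sc' e'] := h' q hq; first by lia.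
by exists (c + c'); [exact: scalD hS _ _ Sc Sc' | rewrite mulrDl e e' (ralgD hral) // mulrDl].
Qed.

Lemma levelM d d' : level d -> level d' -> level (d * d').
Proof.
move=> [L h] [L' h']; exists (maxn L L') => q hq hL.
have [|c Sc e] := h q hq; first by lia.
have [|c' Sc' e'] := h' q hq; first by lia.
exists (c' * c); first exact: scalM hS _ _ Sc' Sc.
by rewrite -mulrA e' mulrA -(ralgZ hral) // -mulrA e mulrA (ralgM hral).
Qed.

Lemma level0 : level 0.
Proof. by rewrite -(ralg0 hS hral); apply: level_scal; exact: scal0 hS. Qed.

Lemma level_sum (I : Type) (s : seq I) (F : I -> B) : (forall i, level (F i)) ->
  level (\sum_(i <- s) F i).
Proof. by move=> h; elim/big_rec: _ => [|i x _ hx]; [exact: level0 | exact: levelD]. Qed.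

Lemma levelC (hG : nosink G) d d' : level d -> level d' -> d * d' = d' * d.
Proof.
move=> [L h] [L' h']; apply: (ext_by_long hF hG (k := maxn L L')) => q hq hL.
have [|c Sc e] := h q hq; first by rewrite hL; lia.
have [|c' Sc' e'] := h' q hq; first by rewrite hL; lia.
rewrite -!mulrA e e' !mulrA -!(ralgZ hral) // -!mulrA e e' !mulrA -!(ralgM hral) //.
by rewrite mulrC.
Qed.

Lemma level_sumE (hG : nosink G) d : level d -> exists L, forall k, (L <= k)%N ->
  exists2 c : vpath G -> cplx, (forall q, S (c q)) /\
     (forall q, okpath q -> (k <= plen q)%N -> d * mn q = iB (c q) * mn q) &
     d = \sum_(q <- paths_of_len G k) iB (c q) * (mn q * ad q).
Proof.
move=> [L h]; exists L => k Lk.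
have /choice [c hc] : forall q, exists c, S c /\ (okpath q -> (k <= plen q)%N -> d * mn q = iB c * mn q).
  move=> q; have [hq|hq] := pselect (okpath q /\ (k <= plen q)%N).
    have [|c Sc e] := h q (proj1 hq); first by case: hq; lia.
    by exists c.
  by exists 0; split=> [|h1 h2]; [exact: scal0 hS | case: hq].
exists c; first by split=> [q|q hq hk]; case: (hc q) => // _ /(_ hq hk).
rewrite -[LHS]mulr1 -(sum_paths_of_len hF hG k) mulr_sumr big_seq [RHS]big_seq.
apply: eq_bigr => q; rewrite mem_paths_of_len => /andP[h1 /eqP h2].
by case: (hc q) => _ e; rewrite mulrA e ?h2 // mulrA.
Qed.

Lemma level_H0 (hG : nosink G) d : level d -> H 0 d.
Proof.
move=> /(level_sumE hG) [L /(_ L (leqnn L)) [c [Sc _] ->]]; rewrite big_seq.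
elim/big_rec: _ => [|q x]; first exact: (grading0 hgr).
rewrite mem_paths_of_len => /andP[h1 _] hx; apply: (gradingD hgr) => //; apply: (gradingZ hgr) => //.
by rewrite -(addrN (plen q)%:Z); apply: (gradingM hgr); [exact: H_mn | exact: H_ad].
Qed.

(** After multiplication by a0^*, paths of the length of a0 other than a0 vanish by orthogonality,
    and those of other lengths land in nonzero degree and are removed by [pi 0]. What is left is
    [c a0] times a vertex. *)
Lemma coef_extract l (c : vpath G -> cplx) a0 : uniq l -> (forall a, S (c a)) ->
  (forall a, a \in l -> okpath a) -> a0 \in l ->
  ad a0 * \sum_(a <- l) iB (c a) * mn a = 0 -> c a0 = 0.
Proof.
move=> ul Sc hl h0 e.
case: (pr_grad hp) => _ _ _ _ [pi [pD hpi]].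
have p0 : pi 0 0 = 0 by rewrite (hpi 0 0 0 (grading0 hgr 0)) eqxx.
apply: (pr_tors hp (v := path_end a0)) => //.
transitivity (pi 0 (ad a0 * \sum_(a <- l) iB (c a) * mn a)); last by rewrite e.
rewrite mulr_sumr (big_morph (pi 0) (pD 0) p0) (bigD1_seq a0) //= big1_seq ?addr0.
  rewrite mulrA -(ralgZ hral) // -mulrA (ad_mn hF) ?hl //.
  by rewrite (hpi 0 0) ?eqxx //; apply: (gradingZ hgr) => //; exact: pr_P hp _.
move=> a /andP[/eqP na al].
rewrite mulrA -(ralgZ hral) // -mulrA.
have [el|nl] := eqVneq (plen a0) (plen a).
  by rewrite (ad_mn0 hF) ?mulr0 ?hl // => ea; apply: na.
rewrite (hpi 0 (- (plen a0)%:Z + (plen a)%:Z)).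
  by case: eqP => // h; case/eqP: nl; lia.
by apply: (gradingZ hgr) => //; apply: (gradingM hgr); [apply: H_ad | apply: H_mn]; exact: hl.
Qed.

Hypothesis hG : branching G.
Let hns : nosink G. Proof. by case: hG. Qed.

Lemma st0 : st 0 = 0.
Proof. by case: (pr_star hp) => sD _; apply: (@addrI _ (st 0)); rewrite -sD !addr0. Qed.
Lemma stM x y : st (x * y) = st y * st x.
Proof. by case: (pr_star hp) => _ [sM _]; exact: sM. Qed.
Lemma stK x : st (st x) = x.
Proof. by case: (pr_star hp) => _ [_ [sK _]]; exact: sK. Qed.
Lemma st_mn q : okpath q -> st (mn q) = ad q.
Proof. exact: (mn_st hF (pr_star hp)). Qed.
Lemma st_ad q : okpath q -> st (ad q) = mn q.
Proof. by move=> h; rewrite -st_mn // stK. Qed.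

(** If neither path extends the other, the empty extension works. Otherwise a2 = a1 p with p closed,
    and branching gives p' of the same length with p^* p' = 0; appending p' to both separates them.
    An exitless cycle p would obstruct this. *)
Lemma incomparable_ext a1 a2 : okpath a1 -> okpath a2 -> path_end a1 = path_end a2 -> a1 <> a2 ->
  exists2 p, gpath (path_end a1) p & ad (catp a2 p) * mn (catp a1 p) = 0.
Proof.
wlog hl : a1 a2 / (plen a1 <= plen a2)%N.
  move=> W h1 h2 e n; have [l|l] := leqP (plen a1) (plen a2); first exact: W.
  have [p hpath h0] := W a2 a1 (ltnW l) h2 h1 (esym e) (fun h => n (esym h)).
  exists p; first by rewrite e.
  have := congr1 st h0; rewrite stM st0 st_mn ?okpath_catp ?h2 // st_ad ?okpath_catp ?h1 //.
  by rewrite e.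
move=> h1 h2 e n; have [q [p [ea hq lq hpath]]] := split_path h2 hl.
have [eq|nq] := EM (q = a1); last first.
  by exists [::] => //; rewrite !catp_nil ea (ad_cat hF) // -mulrA (ad_mn0 hF) ?mulr0.
subst q; have pn : p != [::].
  by apply/eqP => p0; apply: n; rewrite ea p0 catp_nil.
have cl : gend (path_end a1) p = path_end a1 by rewrite [RHS]e ea path_end_catp.
have [p' hp' [sp' np']] := proj2 hG _ _ hpath pn cl.
exists p' => //; rewrite ea (ad_cat hF) ?okpath_catp ?h1 // path_end_catp cl (ad_cat hF) // (mn_cat hF) //.
rewrite -!mulrA (mulrA (ad a1)) (ad_mn hF) // (P_mn hF (path_end a1, p')).
rewrite (ad_mn0 hF (q := (path_end a1, p)) (q' := (path_end a1, p'))) ?mulr0 //.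
by move=> [pp]; apply: np'.
Qed.

Lemma span_catp l (c : vpath G -> cplx) r p : (forall a, a \in l -> okpath a /\ path_end a = r) ->
  (\sum_(a <- l) iB (c a) * mn a) * mn (r, p) = \sum_(a <- l) iB (c a) * mn (catp a p).
Proof.
move=> hl; rewrite mulr_suml big_seq [RHS]big_seq; apply: eq_bigr => a /hl [h1 h2].
by rewrite (mn_cat hF) // h2 mulrA.
Qed.

Lemma coef_extract_cat l (c : vpath G -> cplx) r p a0 : uniq l -> (forall a, S (c a)) ->
  (forall a, a \in l -> okpath a /\ path_end a = r) -> gpath r p -> a0 \in l ->
  ad (catp a0 p) * \sum_(a <- l) iB (c a) * mn (catp a p) = 0 -> c a0 = 0.
Proof.
move=> ul Sc hl hpath h0.
(* Dropping the last [size p] edges recovers a from [catp a p], so c becomes a function of the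
   extended path. *)
pose c' (a : vpath G) := c (a.1, take (size a.2 - size p) a.2).
have c'E a : c' (catp a p) = c a.
  by rewrite /c' /catp /= size_cat addnK take_size_cat //; case: a.
have -> : \sum_(a <- l) iB (c a) * mn (catp a p) =
          \sum_(b <- map (fun a => catp a p) l) iB (c' b) * mn b.
  by rewrite big_map; apply: eq_bigr => a _; rewrite c'E.
move=> e; rewrite -c'E; apply: coef_extract e => //.
- by rewrite map_inj_uniq // => a b; exact: catp_inj.
- by move=> a; exact: Sc.
- by move=> _ /mapP[a /hl [h1 h2] ->]; rewrite okpath_catp h1 h2.
- by apply/mapP; exists a0.
Qed.

Lemma long_ext (r : gV G) k : exists2 p, gpath r p & (k <= size p)%N.
Proof.
have [p] := paths_from_nonnil hns r k; rewrite mem_paths_from => /andP[h /eqP e].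
by exists p => //; rewrite e.
Qed.

Definition normalizer (n : B) :=
  [/\ n * st n * n = n, level (n * st n) & forall d, level d -> level (st n * d * n)].

(** The range projection n n^* is diagonal, so it commutes with d and can be moved across it. *)
Lemma normalizer_comm n d : normalizer n -> level d -> d * n = n * (st n * d * n).
Proof.
move=> [n1 n2 n3] hd; rewrite !mulrA -(levelC hns hd n2).
by rewrite -mulrA n1.
Qed.

(* If a and a' both occur in n q, separate extensions of them by a diagonal projection d.
   As d n = n (n^* d n) with n^* d n diagonal, d acts on n q' by one scalar, for q' a long extension
   of q; that scalar would have to be both 1 and 0. *)
Lemma normalizer_single n : normalizer n -> exists L, forall q, okpath q -> (L <= plen q)%N ->
  n * mn q = 0 \/ exists c a, [/\ S c, c <> 0, okpath a, path_end a = path_end q & n * mn q = iB c * mn a].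
Proof.
move=> hn; have [L hL] := pr_gen hp n; exists L => q hq Lq.
have [l [c [ul Sc hl e]]] := spans_mn_uniq hS hral (hL q hq Lq).
have hl' a : a \in l -> okpath a /\ path_end a = path_end q by move/hl => [].
have single a1 a2 : a1 \in l -> a2 \in l -> c a1 <> 0 -> c a2 <> 0 -> a1 = a2.
  move=> l1 l2 c1 c2; apply: contrapT => n12.
  have [o1 e1 _] := hl _ l1; have [o2 e2 _] := hl _ l2.
  have [p hpath h0] := incomparable_ext o1 o2 (etrans e1 (esym e2)) n12.
  rewrite e1 in hpath.
  pose d := mn (catp a1 p) * ad (catp a1 p).
  have o1p : okpath (catp a1 p) by rewrite okpath_catp o1 e1.
  have o2p : okpath (catp a2 p) by rewrite okpath_catp o2 e2.
  have hd : level d by exact: level_proj.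
  case: (hn) => _ _ /(_ d hd) [K hK].
  have [p' hp' Kp'] := long_ext (gend (path_end q) p) K.
  have oq : okpath (catp q (p ++ p')) by rewrite okpath_catp hq gpath_cat hpath.
  have [|lam Sl el] := hK _ oq; first by rewrite plen_catp size_cat; lia.
  pose x := \sum_(a <- l) iB (c a) * mn (catp a (p ++ p')).
  have xE : n * mn (catp q (p ++ p')) = x.
    by rewrite (mn_cat hF) // mulrA e (span_catp c _ hl').
  have dx : d * x = iB lam * x.
    by rewrite -xE mulrA (normalizer_comm hn hd) -mulrA el mulrA -(ralgZ hral) // -mulrA.
  have ext a : a \in l -> ad (catp a (p ++ p')) =
      ad (gend (path_end q) p, p') * ad (catp a p).
    move=> al; have [oa ea _] := hl _ al.
    have -> : catp a (p ++ p') = catp (catp a p) p' by rewrite /catp /= catA.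
    by rewrite (ad_cat hF) ?okpath_catp ?oa ?ea // path_end_catp ea.
  have hppp : gpath (path_end q) (p ++ p') by rewrite gpath_cat hpath.
  have Sl1 : S (lam - 1) by apply: (scalB hS) => //; exact: scal1 hS.
  (* The projection d fixes what is seen from a1 p p', so (lam - 1) x = d x - x has coefficient 0 at
     a1. *)
  have lam1 : lam - 1 = 0.
    have /cplx_mul_eq0 [] // : (lam - 1) * c a1 = 0.
    apply: (@coef_extract_cat l (fun a => (lam - 1) * c a) (path_end q) (p ++ p') a1) => //.
      by move=> a; exact: (scalM hS).
    rewrite (eq_bigr (fun a => iB (lam - 1) * (iB (c a) * mn (catp a (p ++ p'))))) => [|a _].
      rewrite -mulr_sumr -/x.
      rewrite (ralgB hS hral) //; last exact: scal1 hS.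
      rewrite (ralg1 hral) mulrBl mul1r -dx mulrBr ext // -!mulrA; apply/eqP; rewrite subr_eq0.
      by rewrite /d -?mulrA (mulrA (ad (catp a1 p)) (mn _)) (ad_mn hF) // (mulrA (P _)) (ad_end hF).
    by rewrite (ralgM hral) // mulrA.
  (* With lam = 1, x = d x; but (a2 p)^* d = 0 by the choice of p, so the coefficient at a2
     vanishes. *)
  apply: c2; have l1e : lam = 1 by apply/eqP; rewrite -subr_eq0 lam1.
  apply: (@coef_extract_cat l c (path_end q) (p ++ p') a2) => //.
  rewrite -/x -[x]mul1r -(ralg1 hral) -l1e -dx ext // /d -?mulrA (mulrA (ad (catp a2 p)) (mn _)).
  by rewrite h0 mul0r mulr0.
have [[a [al ca]]|none] := pselect (exists a, a \in l /\ c a <> 0).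
  right; exists (c a), a; have [oa ea _] := hl _ al; split=> //.
  rewrite e (bigD1_seq a) //= big1_seq ?addr0 // => b /andP[/eqP nb bl].
  have -> : c b = 0 by apply: contrapT => cb; apply: nb; exact: single.
  by rewrite (ralg0 hS hral) mul0r.
left; rewrite e big1_seq // => a /andP[_ al].
have -> : c a = 0 by apply: contrapT => ca; apply: none; exists a.
by rewrite (ralg0 hS hral) mul0r.
Qed.

(** The diagonal contains its commutant. If b other than q occurred in a q, extend both by p to
    orthogonal paths; a commutes with the projection of q p, so a q p lies under that projection and
    has no part along b p. *)
Lemma level_max_comm a : (forall d, level d -> a * d = d * a) -> level a.
Proof.
move=> ha; have [L hL] := pr_gen hp a; exists L => q hq Lq.
have [l [c [ul Sc hl e]]] := spans_mn_uniq hS hral (hL q hq Lq).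
have hl' b : b \in l -> okpath b /\ path_end b = path_end q by move/hl => [].
have single b : b \in l -> b <> q -> c b = 0.
  move=> bl nb; have [ob eb _] := hl _ bl.
  have [p hpath h0] := incomparable_ext hq ob (esym eb) (fun h => nb (esym h)).
  apply: (coef_extract_cat ul Sc hl' hpath bl).
  rewrite -(span_catp c _ hl') -e -mulrA -(mn_cat hF) //.
  have oq : okpath (catp q p) by rewrite okpath_catp hq.
  have -> : mn (catp q p) = mn (catp q p) * ad (catp q p) * mn (catp q p).
    by rewrite -mulrA (ad_mn hF) // (mn_end hF).
  by rewrite (mulrA a) ha; [rewrite !mulrA h0 !mul0r | exact: level_proj].
exists (if q \in l then c q else 0); first by case: ifP => // _; exact: scal0 hS.
case: ifP => ql; rewrite e; last first.
  rewrite (ralg0 hS hral) mul0r big1_seq // => b /andP[_ bl].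
  by rewrite single ?(ralg0 hS hral) ?mul0r // => h; rewrite -h bl in ql.
rewrite (bigD1_seq q) //= big1_seq ?addr0 // => b /andP[/eqP nb bl].
by rewrite single // (ralg0 hS hral) mul0r.
Qed.

Lemma level_diag d : level d <-> in_diagonal S iB P X Y d.
Proof.
split.
  move=> /(level_sumE hns) [L /(_ L (leqnn L)) [c [Sc _] ->]].
  exists (size (paths_of_len G L)), (fun i => c (tnth (in_tuple (paths_of_len G L)) i)),
    (fun i => (tnth (in_tuple (paths_of_len G L)) i).1), (fun i => (tnth (in_tuple (paths_of_len G L)) i).2); split.
    move=> i; split=> //; have := mem_tnth i (in_tuple (paths_of_len G L)).
    by rewrite memtE /= mem_paths_of_len => /andP[].
  rewrite big_tnth; apply: eq_bigr => i _; by rewrite mnE adE.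
move=> [n [c [v [p [h ->]]]]]; apply: level_sum => i; case: (h i) => h1 h2.
apply: levelM; first exact: level_scal.
by have := @level_proj (v i, p i) h2; rewrite mnE adE.
Qed.
End Presentation.

(** * Line graphs *)

Section LineGraph.
Variable G : lgraph.

Definition edge_pair := {ef : gE G * gE G | rng ef.1 == src ef.2}.
Definition linegraph : lgraph :=
  @LGraph (gE G) edge_pair (fun x => (val x).1) (fun x => (val x).2).

Definition snds (p : seq (gE linegraph)) : seq (gE G) := [seq (val x).2 | x <- p].

Lemma lg_gpath (e : gV linegraph) p : gpath e p -> gpath (rng (e : gE G)) (snds p).
Proof.
elim: p e => //= x p IH e /andP[/eqP <- /IH h].
by rewrite h andbT eq_sym; exact: valP x.
Qed.

Lemma lg_gend (e : gV linegraph) p : gend e p = last (e : gE G) (snds p).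
Proof. by []. Qed.

Lemma lg_gend_rng (e : gV linegraph) p : gend (rng (e : gE G)) (snds p) = rng (gend e p : gE G).
Proof. by rewrite /gend last_map. Qed.

Lemma lg_lift (e : gE G) r : gpath (rng e) r ->
  exists2 p, gpath (G := linegraph) e p & snds p = r.
Proof.
elim: r e => [|f r IH] e /=; first by exists [::].
move=> /andP[hf /IH [p hp e2]]; have h : rng (e, f).1 == src (e, f).2 by rewrite eq_sym.
by exists ((exist _ (e, f) h : gE linegraph) :: p); rewrite /= ?eqxx // e2.
Qed.

Lemma lg_branching : branching G -> branching linegraph.
Proof.
move=> [hns hc]; split.
  move=> e; have [f hf] := hns (rng (e : gE G)).
  have h : rng (e, f).1 == src (e, f).2 by rewrite eq_sym hf.
  by exists (exist _ (e, f) h).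
move=> e p hp pn cl.
have [||r hr [sr nr]] := hc _ _ (lg_gpath hp); first by case: (p) pn.
  by rewrite lg_gend_rng cl.
have [p' hp' e'] := lg_lift hr; exists p' => //; split.
  by rewrite -(size_map (fun x => (val x).2) p') -/(snds p') e' sr size_map.
by move=> pp; apply: nr; rewrite -e' pp.
Qed.

(* The path of G underlying a path of the line graph, which is one edge longer. *)
Definition und (q : vpath linegraph) : vpath G := (src (q.1 : gE G), (q.1 : gE G) :: snds q.2).

Lemma okpath_und (q : vpath linegraph) : okpath q -> okpath (und q).
Proof. by rewrite /okpath /= eqxx; exact: lg_gpath. Qed.
Lemma path_end_und (q : vpath linegraph) : path_end (und q) = rng (@path_end linegraph q : gE G).
Proof. by rewrite /path_end -lg_gend_rng. Qed.
Lemma plen_und q : plen (und q) = (plen q).+1.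
Proof. by rewrite /plen /= size_map. Qed.

Lemma und_last (q : vpath linegraph) : okpath q -> exists q0 : vpath G,
  [/\ okpath q0, path_end q0 = src (@path_end linegraph q : gE G), plen q0 = plen q &
      und q = catp q0 [:: @path_end linegraph q : gE G]].
Proof.
move=> hq; pose l : gE G := last (q.1 : gE G) (snds q.2).
have e : und q = catp (src (q.1 : gE G), belast (q.1 : gE G) (snds q.2)) [:: l].
  by rewrite /catp /und /= lastI cats1.
have := okpath_und hq; rewrite e okpath_catp => /andP[h1 /= /andP[/eqP h2 _]].
exists (src (q.1 : gE G), belast (q.1 : gE G) (snds q.2)); split=> //.
by rewrite /plen /= size_belast size_map.
Qed.

Lemma lift_last (a : vpath G) (l : gE G) : okpath a -> path_end a = src l ->
  exists q : vpath linegraph, [/\ okpath q, und q = catp a [:: l] & path_end q = l].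
Proof.
case: a => w s ha hl.
have : okpath (catp (w, s) [:: l]) by rewrite okpath_catp ha /= hl eqxx.
rewrite /catp /okpath /=; case es : (s ++ [:: l]) => [|e r] /=; first by case: (s) es.
move=> /andP[/eqP <- /lg_lift [p hp e2]]; exists (e, p); split=> //.
  by rewrite /und /= e2.
by rewrite /path_end lg_gend e2 /=; have := congr1 (last l) es; rewrite last_cat /= => ->.
Qed.
End LineGraph.

Section LineFamily.
Variables (S : cplx -> Prop) (hS : conj_closed_unital_subring S) (G : lgraph).
Variables (B : pzRingType) (iB : cplx -> B) (st : B -> B).
Variables (P : gV G -> B) (X Y : gE G -> B) (H : int -> B -> Prop).
Hypothesis (hp : leavitt_pres S iB st P X Y H) (hG : branching G).

Let hral := pr_alg hp.
Let hF := pr_fam hp.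

Definition lgP (e : gV (linegraph G)) : B := X e * Y e.
Definition lgX (x : gE (linegraph G)) : B := X (val x).1 * (X (val x).2 * Y (val x).2).
Definition lgY (x : gE (linegraph G)) : B := X (val x).2 * Y (val x).2 * Y (val x).1.

Lemma XYX e : X e * Y e * X e = X e.
Proof. by rewrite -mulrA (famYX hF) (famXP hF). Qed.
Lemma YXY e : Y e * X e * Y e = Y e.
Proof. by rewrite (famYX hF) (famPY hF). Qed.
Lemma XYXY e : X e * Y e * (X e * Y e) = X e * Y e.
Proof. by rewrite mulrA XYX. Qed.

Lemma lg_family : unital_leavitt_family lgP lgX lgY.
Proof.
have [hns _] := hG.
have PX2 (x : gE (linegraph G)) : P (rng (val x).1) * X (val x).2 = X (val x).2.
  by rewrite (eqP (valP x)) (famPX hF).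
have PXY (x : gE (linegraph G)) :
    P (rng (val x).1) * (X (val x).2 * Y (val x).2) = X (val x).2 * Y (val x).2.
  by rewrite mulrA PX2.
split; last first.
  rewrite -(fam1 hF) (partition_big (@src G) xpredT) //=.
  by apply: eq_bigr => v _; rewrite (famP hF) //; exact: hns.
split; first by move=> e; exact: XYXY.
split; first by move=> e f h; rewrite /lgP mulrA -(mulrA (X e)) (famYX0 hF) ?mulr0 ?mul0r.
split.
  move=> x y nxy; rewrite /lgY /lgX mulrA -(mulrA _ (Y (val x).1)).
  have [e1|n1] := eqVneq (val x).1 (val y).1; last by rewrite (famYX0 hF) // mulr0 mul0r.
  rewrite e1 (famYX hF) -mulrA PXY mulrA -(mulrA (X _)) (famYX0 hF) ?mulr0 ?mul0r //.
  apply: contra nxy => /eqP e2; apply/eqP/val_inj.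
  by move: e1 e2; case: (val x) (val y) => [? ?] [? ?] /= -> ->.
split.
  move=> x; rewrite /lgY /lgX mulrA -(mulrA _ (Y (val x).1)) (famYX hF) -!mulrA PXY.
  by rewrite mulrA XYXY.
split.
  move=> x; rewrite /lgP /lgX /=; split; first by rewrite mulrA XYX.
  by rewrite -mulrA XYXY.
split.
  move=> x; rewrite /lgP /lgY /=; split; first by rewrite -!mulrA (mulrA (Y (val x).1)) YXY.
  by rewrite mulrA XYXY.
move=> e _; rewrite /lgP /lgX /lgY /=.
have -> : X e * Y e = \sum_(f | src f == rng e) X e * (X f * Y f) * Y e.
  rewrite -mulr_suml -mulr_sumr -(famP hF) ?(famXP hF) //; exact: hns.
(* Edges of the line graph leaving e correspond to the edges f of G that may follow e. *)
rewrite (reindex_omap (fun x : edge_pair G => (val x).2) (fun f => insub (e, f))) /=; last first.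
  by move=> f hf; rewrite insubT //= eq_sym.
apply: eq_big => [x|x /andP[_ h]].
  apply/andP/eqP => [[_]|ex].
    by case: insubP => // u _ eu /eqP[<-]; rewrite eu.
  have hx := valP x; rewrite /= ex in hx; split; first by rewrite eq_sym.
  case: insubP => [u _ eu|]; last by rewrite /= hx.
  apply/eqP; congr Some; apply: val_inj; rewrite eu -ex; exact: esym (surjective_pairing _).
have <- : (val x).1 = e.
  by move: h; case: insubP => // u _ eu /eqP[<-]; rewrite eu.
by rewrite [RHS]mulrA -[in RHS](mulrA (X _)) XYXY.
Qed.

Local Notation mn' := (mn lgP lgX).
Local Notation mn := (mn P X).

(** Each factor e f f^* ends in a ghost edge that is absorbed by the next factor; only the last one
    survives. *)
Lemma lg_mn (q : vpath (linegraph G)) : okpath q -> mn' q = mn (und q) * Y (@path_end (linegraph G) q).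
Proof.
have mn1 e : mn (src e, [:: e]) = X e by rewrite (mn_cons hF) mn_nil (famXP hF).
case: q => e p; elim: p e => [|x p IH] e.
  by rewrite mn_nil /und /= mn1.
rewrite {1}/okpath /= => /andP[/eqP <- h].
rewrite (mn_cons lg_family) (IH _ h) /lgX.
have e1 : mn (und ((val x).2 : gV (linegraph G), p)) = X (val x).2 * mn (rng (val x).2, snds p) :=
  mn_cons hF (val x).2 (snds p).
have e2 : mn (src (val x).1, (val x).1 :: (val x).2 :: snds p) =
    X (val x).1 * (X (val x).2 * mn (rng (val x).2, snds p)).
  by rewrite (mn_cons hF) (eqP (valP x)) -e1.
rewrite [LHS]mulrA; congr (_ * _); apply: etrans (esym e2).
by rewrite [mn (und _)]e1 -!mulrA; congr (_ * _); rewrite !mulrA XYX.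
Qed.

Lemma lg_level d : level S iB lgP lgX d <-> level S iB P X d.
Proof.
split=> -[L h].
  exists L.+1 => q hq hL.
  have [|q1 [p [eq o1 l1 hpath]]] := split_path (n := (plen q).-1) hq; first by lia.
  have : size p = 1%N by have := congr1 (@plen G) eq; rewrite plen_catp l1; lia.
  case: p eq hpath => [|l [|]] // eq /andP[/eqP sl _] _.
  have [q' [o' u' e']] := lift_last o1 (esym sl).
  have [|c Sc hc] := h q' o'; first by have := plen_und q'; rewrite u' plen_catp l1 /=; lia.
  exists c => //; rewrite eq -u'.
  have -> : mn (und q') = mn' q' * X l.
    by rewrite lg_mn // e' -mulrA (famYX hF) -e' -path_end_und (mn_end hF) //; exact: okpath_und.
  by rewrite mulrA hc mulrA.
exists L => q hq hL; have [|c Sc hc] := h (und q) (okpath_und hq); first by rewrite plen_und; lia.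
by exists c => //; rewrite lg_mn // mulrA hc mulrA.
Qed.

Lemma lg_leavitt_pres : leavitt_pres S iB st lgP lgX lgY H.
Proof.
have [sD [sM [sK [si [sP sX]]]]] := pr_star hp.
have sY e : st (Y e) = X e by rewrite -sX sK.
have H0 e : H 0 (X e * Y e).
  by rewrite -(addrN 1); apply: (gradingM (pr_grad hp)); [exact: pr_X hp e | exact: pr_Y hp e].
split=> //.
- exact: lg_family.
- split=> //; split=> //; split=> //; split=> //; split.
    by move=> e; rewrite /lgP sM sX sY.
  by move=> x; rewrite /lgX /lgY !sM !sX sY.
- move=> c e hc h0; apply: (pr_tors hp (v := rng (e : gE G))) => //.
  rewrite -(famYX hF); have -> : iB c * (Y e * X e) = Y e * (iB c * lgP e) * X e.
    by rewrite /lgP !mulrA -(ralgZ hral (Y e) hc) -!mulrA (mulrA (X e)) XYX.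
  by rewrite h0 mulr0 mul0r.
- move=> b; have [L h] := pr_gen hp b; exists L => q hq hL.
  have [q0 [o0 e0 l0 u0]] := und_last hq.
  have [|s [hs es]] := h q0 o0; first by rewrite l0.
  (* f rewrites a path a of G, followed by the last edge of q and its ghost, as a path of the line
     graph; q is a dummy value where a does not fit. *)
  have /choice [f hf] : forall a : vpath G, exists q' : vpath (linegraph G), okpath a -> path_end a = path_end q0 ->
      [/\ okpath q', path_end q' = path_end q & mn a * mn (path_end q0, [:: @path_end (linegraph G) q : gE G]) * Y (@path_end (linegraph G) q) = mn' q'].
    move=> a; have [[oa ea]|na] := pselect (okpath a /\ path_end a = path_end q0); last first.
      by exists q => oa ea; case: na.
    have [q' [o' u' e']] := lift_last oa (etrans ea e0); exists q' => _ _; split=> //.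
    by rewrite lg_mn // u' (mn_cat hF) // ea e'.
  exists [seq (z.1, f z.2) | z <- s]; split.
    move=> _ /mapP[z zs ->] /=; case: (hs z zs) => h1 h2 h3 _.
    by case: (hf z.2 h2 h3) => ? ? _; split.
  rewrite lg_mn // u0 (mn_cat hF) // !mulrA es !mulr_suml big_map big_seq [RHS]big_seq.
  apply: eq_bigr => z zs; case: (hs z zs) => h1 h2 h3 _.
  by case: (hf z.2 h2 h3) => _ _ /= <-; rewrite !mulrA.
- exact: pr_grad hp.
- by move=> x; rewrite -[1]addr0; apply: (gradingM (pr_grad hp)); [exact: pr_X hp _ | exact: H0].
- by move=> x; rewrite -[-1]add0r; apply: (gradingM (pr_grad hp)); [exact: H0 | exact: pr_Y hp _].
Qed.
End LineFamily.

(** Sylvester's identity, from two triangular factorizations of the block matrix (1 A; C 1). *)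
Lemma det_sub_mulC (R : comNzRingType) m n (A : 'M[R]_(m, n)) (C : 'M[R]_(n, m)) :
  \det (1%:M - A *m C) = \det (1%:M - C *m A).
Proof.
have e1 : block_mx 1%:M A C 1%:M = block_mx 1%:M 0 C 1%:M *m block_mx 1%:M A 0 (1%:M - C *m A).
  rewrite mulmx_block; congr block_mx; rewrite ?mul1mx ?mulmx1 ?mul0mx ?mulmx0 ?addr0 //.
  by rewrite addrC subrK.
have e2 : block_mx 1%:M A C 1%:M = block_mx (1%:M - A *m C) A 0 1%:M *m block_mx 1%:M 0 C 1%:M.
  rewrite mulmx_block; congr block_mx; rewrite ?mul1mx ?mulmx1 ?mul0mx ?mulmx0 ?addr0 ?add0r //.
  by rewrite subrK.
have := congr1 determinant e1; rewrite e2 !det_mulmx !det_ublock !det_lblock !det1.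
by rewrite !mul1r !mulr1.
Qed.

Lemma card_set_sum (T : finType) (p : pred T) :
  (#|[set x | p x]| : int) = \sum_x (p x)%:R.
Proof. by rewrite -sum1_card (eq_bigl p) => [|x]; rewrite ?inE // -natz big_mkcond natr_sum /=; apply: eq_bigr => x _; case: (p x). Qed.

(** With R the source and C the range incidence matrix, the adjacency matrices are R C for G and C R
    for its line graph. *)
Lemma lg_det (G : lgraph) :
  \det (1%:M - adjmx (linegraph G)) = \det (1%:M - adjmx G).
Proof.
pose R : 'M[int]_(#|gV G|, #|gE G|) := \matrix_(i, k) (src (enum_val k) == enum_val i)%:R.
pose C : 'M[int]_(#|gE G|, #|gV G|) := \matrix_(k, j) (rng (enum_val k) == enum_val j)%:R.
have -> : adjmx G = R *m C.
  apply/matrixP => i j; rewrite !mxE card_set_sum (reindex (@enum_val _ (gE G))) /=; last first.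
    by apply: onW_bij; exact: enum_val_bij.
  by apply: eq_bigr => k _; rewrite !mxE -natrM mulnb.
have -> : adjmx (linegraph G) = C *m R.
  apply/matrixP => k l; rewrite !mxE.
  have -> : \sum_j C k j * R j l = (rng (enum_val k) == src (enum_val l))%:R.
    rewrite (bigD1 (enum_rank (rng (enum_val k)))) //= big1 ?addr0.
      by rewrite !mxE enum_rankK eqxx mul1r eq_sym.
    move=> j nj; rewrite !mxE; case: eqP => [h|]; rewrite ?mul0r //.
    by rewrite h enum_valK eqxx in nj.
  have [h|h] := boolP (rng (enum_val k) == src (enum_val l)).
    rewrite (_ : [set e | _] = [set (exist _ (enum_val k, enum_val l) h : gE (linegraph G))]) ?cards1 //.
    apply/setP => x; rewrite !inE; apply/andP/eqP => [[/eqP h1 /eqP h2]|-> //].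
    by apply: val_inj; rewrite /= -h1 -h2; exact: surjective_pairing.
  rewrite (_ : [set e | _] = set0) ?cards0 //.
  apply/setP => x; rewrite !inE; apply/negP => /andP[/eqP h1 /eqP h2].
  by move/negP: h; apply; rewrite -h1 -h2; exact: valP x.
by rewrite det_sub_mulC.
Qed.

Section Iterate.
Variables (S : cplx -> Prop) (hS : conj_closed_unital_subring S) (G : lgraph).
Variables (B : pzRingType) (iB : cplx -> B) (st : B -> B).
Variables (P : gV G -> B) (X Y : gE G -> B) (H : int -> B -> Prop).
Hypothesis (hp : leavitt_pres S iB st P X Y H) (hG : branching G).

(** The last two clauses serve homogenization: each new edge is an old edge cut down on the right by
    a new vertex, and each new vertex is the projection of a cylinder of length N. *)
Lemma iterated_linegraph N : exists (G' : lgraph) (P' : gV G' -> B) (X' Y' : gE G' -> B),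
  [/\ leavitt_pres S iB st P' X' Y' H, branching G',
      forall d, level S iB P' X' d <-> level S iB P X d,
      \det (1%:M - adjmx G') = \det (1%:M - adjmx G) &
      (forall x, exists e, X' x = X e * P' (rng x)) /\
      (forall v, exists q, [/\ okpath q, plen q = N & P' v = mn P X q * ad P Y q])].
Proof.
have hF := pr_fam hp.
elim: N => [|N [G' [P' [X' [Y' [hp' hG' hl' hd' [hX' hP']]]]]]].
  exists G, P, X, Y; split=> //; split.
    by move=> e; exists e; rewrite (famXP hF).
  by move=> v; exists (v, [::]); split=> //; rewrite mn_nil ad_nil (famPP hF).
have hF' := pr_fam hp'.
exists (linegraph G'), (lgP X' Y'), (lgX X' Y'), (lgY X' Y'); split.
- exact: (lg_leavitt_pres hp' hG').
- exact: (lg_branching hG').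
- by move=> d; rewrite -hl'; exact: (lg_level hp' hG').
- by rewrite lg_det.
split.
  move=> x; have [e he] := hX' (val x).1; exists e.
  rewrite /lgX he -mulrA; congr (_ * _).
  by rewrite (eqP (valP x)) mulrA (famPX hF').
move=> x; have [e he] := hX' x; have [q [oq lq eq]] := hP' (rng x).
have [sD [sM [sK [si [sP sX]]]]] := pr_star hp.
have [_ [_ [_ [_ [sP' sX']]]]] := pr_star hp'.
have e1 : lgP X' Y' x = (X e * mn P X q) * (ad P Y q * Y e).
  rewrite /lgP -sX' he sM sP' sX mulrA -(mulrA (X e)) (famPP hF') eq.
  by rewrite !mulrA.
(* If e and q did not compose, the vertex x of the line graph would be 0, against
   torsion-freeness. *)
have [h|h] := eqVneq (rng e) q.1; last first.
  have := pr_tors (lg_leavitt_pres hp' hG') (v := x) (scal1 hS).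
  rewrite e1 -(famXP hF e) -(mulrA (X e)) (P_mn0 hF) // mulr0 mul0r mulr0 => /(_ erefl).
  by move=> h1; have := @cplx_natr_inj 1 0 h1.
exists (src e, e :: q.2); split=> //.
- by rewrite /okpath /= eqxx h.
- by rewrite /plen /= -lq.
rewrite (mn_cons hF) (ad_cons hF) h e1.
by case: (q).
Qed.
End Iterate.

(** * Weighted cylinders *)

Section Congruence.
Variables (K : fieldType) (Lam : K -> Prop).

(** Laurent polynomials are treated as a subset of their fraction field, so that matrices and
    integer powers of t live over a field while [Lam] records integrality. *)
Record subring_pred : Prop := SubringPred {
  lam1 : Lam 1 ;
  lamB : forall x y, Lam x -> Lam y -> Lam (x - y) ;
  lamM : forall x y, Lam x -> Lam y -> Lam (x * y) }.

Hypothesis hL : subring_pred.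

Lemma lam0 : Lam 0. Proof. rewrite -(subrr 1); apply: (lamB hL); exact: lam1. Qed.
Lemma lamN x : Lam x -> Lam (- x).
Proof. by move=> h; rewrite -[- x]sub0r; apply: (lamB hL) => //; exact: lam0. Qed.
Lemma lamD x y : Lam x -> Lam y -> Lam (x + y).
Proof. by move=> hx hy; rewrite -[y]opprK; apply: (lamB hL) => //; exact: lamN. Qed.
Lemma lam_sum (I : Type) (s : seq I) (p : pred I) (F : I -> K) :
  (forall i, p i -> Lam (F i)) -> Lam (\sum_(i <- s | p i) F i).
Proof. by move=> h; apply: (big_ind Lam) => //; [exact: lam0 | exact: lamD]. Qed.
Lemma lam_prod (I : Type) (s : seq I) (p : pred I) (F : I -> K) :
  (forall i, p i -> Lam (F i)) -> Lam (\prod_(i <- s | p i) F i).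
Proof. by move=> h; apply: (big_ind Lam) => //; [exact: lam1 hL | exact: lamM hL]. Qed.

Definition lam_mx m n (A : 'M[K]_(m, n)) := forall i j, Lam (A i j).

Lemma lam_mxD m n (A C : 'M[K]_(m, n)) : lam_mx A -> lam_mx C -> lam_mx (A + C).
Proof. by move=> hA hC i j; rewrite mxE; exact: lamD. Qed.
Lemma lam_mxN m n (A : 'M[K]_(m, n)) : lam_mx A -> lam_mx (- A).
Proof. by move=> hA i j; rewrite mxE; exact: lamN. Qed.
Lemma lam_mxZ m n c (A : 'M[K]_(m, n)) : Lam c -> lam_mx A -> lam_mx (c *: A).
Proof. by move=> hc hA i j; rewrite mxE; exact: lamM hL _ _ hc (hA i j). Qed.
Lemma lam_mx0 m n : lam_mx (0 : 'M[K]_(m, n)).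
Proof. by move=> i j; rewrite mxE; exact: lam0. Qed.
Lemma lam_delta m n i0 j0 : lam_mx (delta_mx i0 j0 : 'M[K]_(m, n)).
Proof. by move=> i j; rewrite mxE; case: (_ && _); [exact: lam1 hL | exact: lam0]. Qed.
Lemma lam_det n (A : 'M[K]_n) : lam_mx A -> Lam (\det A).
Proof.
move=> hA; apply: lam_sum => s _; apply: (lamM hL).
  rewrite -signr_odd; case: (odd _); rewrite ?expr1 ?expr0; last exact: lam1 hL.
  by apply: lamN; exact: lam1 hL.
by apply: lam_prod => i _; exact: hA.
Qed.

Variables (n : nat) (M : 'M[K]_n).

(* Equality in the cokernel of M over the subring Lam. *)
Definition congr_mod (u v : 'rV[K]_n) := exists2 w : 'rV[K]_n, lam_mx w & u - v = w *m M.

Lemma congr_refl u : congr_mod u u.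
Proof. by exists 0; rewrite ?subrr ?mul0mx //; exact: lam_mx0. Qed.
Lemma congr_sym u v : congr_mod u v -> congr_mod v u.
Proof. by move=> [w hw e]; exists (- w); [exact: lam_mxN | rewrite mulNmx -e opprB]. Qed.
Lemma congr_trans u v w : congr_mod u v -> congr_mod v w -> congr_mod u w.
Proof.
move=> [x hx ex] [y hy ey]; exists (x + y); first exact: lam_mxD.
by rewrite mulmxDl -ex -ey addrA subrK.
Qed.
Lemma congrD u v u' v' : congr_mod u v -> congr_mod u' v' -> congr_mod (u + u') (v + v').
Proof.
move=> [x hx ex] [y hy ey]; exists (x + y); first exact: lam_mxD.
by rewrite mulmxDl -ex -ey opprD addrACA.
Qed.
Lemma congrZ c u v : Lam c -> congr_mod u v -> congr_mod (c *: u) (c *: v).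
Proof.
by move=> hc [x hx ex]; exists (c *: x); [exact: lam_mxZ | rewrite -scalemxAl -ex scalerBr].
Qed.
Lemma congr_sum (I : eqType) (s : seq I) (F F' : I -> 'rV[K]_n) :
  (forall i, i \in s -> congr_mod (F i) (F' i)) ->
  congr_mod (\sum_(i <- s) F i) (\sum_(i <- s) F' i).
Proof.
elim: s => [|i s IH] h; first by rewrite !big_nil; exact: congr_refl.
rewrite !big_cons; apply: congrD; first by apply: h; exact: mem_head.
by apply: IH => j js; apply: h; rewrite inE js orbT.
Qed.
End Congruence.

Section Classes.
Variables (S : cplx -> Prop) (hS : conj_closed_unital_subring S) (G : lgraph).
Variables (B : pzRingType) (iB : cplx -> B) (st : B -> B).
Variables (P : gV G -> B) (X Y : gE G -> B) (H : int -> B -> Prop).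
Hypothesis (hp : leavitt_pres S iB st P X Y H) (hG : branching G).

Variables (HH : int -> B -> Prop) (c : gE G -> int).
Hypothesis hgr : grading S iB HH.
Hypothesis hP : forall v, HH 0 (P v).
Hypothesis hc : forall e, HH (c e) (X e).

Local Notation mn := (mn P X).
Local Notation ad := (ad P Y).
Local Notation level := (level S iB P X).
Local Notation normalizer := (normalizer S iB st P X).

Let hral := pr_alg hp.
Let hF := pr_fam hp.
Let hns : nosink G. Proof. by case: hG. Qed.

(** Here c is the degree of edges in [HH], which may be the length grading of another graph
    presenting the same ring. *)
Definition weight (q : vpath G) : int := \sum_(e <- q.2) c e.

Lemma weight_catp q p : weight (catp q p) = weight q + \sum_(e <- p) c e.
Proof. exact: big_cat. Qed.

Lemma HH_mn q : okpath q -> HH (weight q) (mn q).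
Proof.
case: q => v p; elim: p v => [|e p IH] v.
  by rewrite mn_nil /weight big_nil => _; exact: hP.
rewrite {1}/okpath /= => /andP[/eqP <- h]; rewrite (mn_cons hF) /weight /= big_cons.
by apply: (gradingM hgr) => //; exact: IH.
Qed.

Lemma P_neq0 v : P v <> 0.
Proof.
move=> h; have := pr_tors hp (v := v) (scal1 hS).
by rewrite h mulr0 => /(_ erefl) h1; have := @cplx_natr_inj 1 0 h1.
Qed.

Lemma mn_neq0 q : okpath q -> mn q <> 0.
Proof. by move=> hq h; apply: (@P_neq0 (path_end q)); rewrite -(ad_mn hF) // h mulr0. Qed.

Lemma mn_normalizer q : okpath q -> normalizer (mn q).
Proof.
move=> hq; have sq := st_mn hp hq; split.
- by rewrite sq -mulrA (ad_mn hF) // (mn_end hF).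
- by rewrite sq; exact: (level_proj hS hp hq).
move=> d [L hd]; exists L => -[w p] ow Lp; rewrite sq.
have [h|h] := eqVneq w (path_end q).
  have oqp : okpath (catp q p) by rewrite okpath_catp hq -h.
  have [|k Sk hk] := hd _ oqp; first by rewrite plen_catp; move: Lp; rewrite /plen /=; lia.
  exists k => //; rewrite -!mulrA h -(mn_cat hF) // hk (mn_cat hF) // !mulrA -(ralgZ hral) //.
  by rewrite -!mulrA (mulrA (ad q)) (ad_mn hF) // (P_mn hF (path_end q, p)).
exists 0; first exact: scal0 hS.
rewrite (ralg0 hS hral) mul0r -(mn_end hF hq) -!mulrA (P_mn0 hF) ?mulr0 //=.
by rewrite eq_sym.
Qed.

(** By [normalizer_single], n q is 0 or b a. The condition n^* n q = q excludes 0 and forces b to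
    have modulus 1, so b drops out of the conjugated projection; comparing degrees gives the weight
    of a. *)
Lemma normalizer_map n k : normalizer n -> HH k n -> exists L (f : vpath G -> vpath G),
  forall q, okpath q -> (L <= plen q)%N -> st n * n * mn q = mn q ->
  [/\ okpath (f q), path_end (f q) = path_end q, weight (f q) = k + weight q &
      mn (f q) * ad (f q) = n * (mn q * ad q) * st n].
Proof.
move=> hn hk; have [L hL'] := normalizer_single hS hp hG hn; exists L.
pose R q a := okpath q -> (L <= plen q)%N -> st n * n * mn q = mn q ->
  [/\ okpath a, path_end a = path_end q, weight a = k + weight q & mn a * ad a = n * (mn q * ad q) * st n].
suff /choice [f hf] : forall q, exists a, R q a by exists f.
move=> q; rewrite /R; have [[oq [Lq nq]]|no] := pselect (okpath q /\ (L <= plen q)%N /\ st n * n * mn q = mn q);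
  last by exists q => h1 h2 h3; case: no.
have [h|[b [a [Sb b0 oa ea e]]]] := hL' q oq Lq.
  by case: (mn_neq0 oq); rewrite -nq -mulrA h mulr0.
exists a => _ _ _.
have [sD [sM [sK [si [sP sX]]]]] := pr_star hp.
have sb : st (iB b * mn a) = ad a * iB (Cconj b) by rewrite sM si // (st_mn hp).
have Scb := scalC hS Sb.
have bb : b * Cconj b = 1.
  apply/eqP; rewrite -subr_eq0; apply/eqP; apply: (pr_tors hp (v := path_end q)).
    by apply: (scalB hS); [exact: scalM hS _ _ Sb Scb | exact: scal1 hS].
  rewrite (ralgB hS hral) //; [|exact: scalM hS _ _ Sb Scb|exact: scal1 hS].
  rewrite (ralg1 hral) mulrBl mul1r -{1}ea -(ad_mn hF oa) -(ad_mn hF oq) -{1}nq.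
  have -> : ad q * (st n * n * mn q) = st (n * mn q) * (n * mn q).
    by rewrite sM (st_mn hp) // !mulrA.
  rewrite e sb -(ralgZ hral (ad a) Scb) mulrC (ralgM hral) // -!mulrA.
  by rewrite (mulrA (ad a)) -(ralgZ hral (ad a) Sb) -!mulrA subrr.
split=> //.
- apply: (grading_uniq hgr (a := n * mn q)).
  + by rewrite e; apply: (gradingZ hgr) => //; exact: HH_mn.
  + by apply: (gradingM hgr) => //; exact: HH_mn.
  + by move=> h0; apply: (mn_neq0 oq); rewrite -nq -mulrA h0 mulr0.
have -> : n * (mn q * ad q) * st n = (n * mn q) * st (n * mn q).
  by rewrite sM (st_mn hp) // !mulrA.
rewrite e sb -(ralgZ hral (ad a) Scb) -!mulrA (mulrA (mn a)) -(ralgZ hral (mn a) Scb).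
by rewrite -mulrA mulrA -(ralgM hral) // bb (ralg1 hral) mul1r.
Qed.

(** A list of paths is a formal sum of cylinders, with multiplicity: [cyl_sum] is its value in the
    ring, [cyl_class] its class in the cokernel of [rel_mx]. *)
Definition cyl_sum (s : seq (vpath G)) : B := \sum_(q <- s) mn q * ad q.

Lemma cyl_sum_cat s s' : cyl_sum (s ++ s') = cyl_sum s + cyl_sum s'.
Proof. exact: big_cat. Qed.

(** Cuts all cylinders to length L; by truncated subtraction those already longer stay as they
    are. *)
Definition refine (L : nat) (s : seq (vpath G)) : seq (vpath G) :=
  flatten [seq [seq catp q p | p <- paths_from (path_end q) (L - plen q)] | q <- s].

Lemma refineP L s a : (forall q, q \in s -> okpath q /\ (plen q <= L)%N) -> a \in refine L s ->
  exists q p, [/\ q \in s, okpath a, plen a = L, gpath (path_end q) p & a = catp q p].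
Proof.
move=> hs /flattenP[r /mapP[q qs ->] /mapP[p pp ->]]; exists q, p.
move: pp; rewrite mem_paths_from => /andP[h1 /eqP h2]; have [oq lq] := hs q qs.
by split=> //; rewrite ?okpath_catp ?oq ?plen_catp ?h2 //; lia.
Qed.

Lemma refine_cyl_sum L s : (forall q, q \in s -> okpath q) -> cyl_sum (refine L s) = cyl_sum s.
Proof.
move=> hs; rewrite /cyl_sum big_flatten big_map big_seq [RHS]big_seq; apply: eq_bigr => q qs.
by rewrite big_map (sum_ext hF) //; exact: hs.
Qed.

Lemma count_cyl_sum q0 L s : okpath q0 -> plen q0 = L ->
  (forall q, q \in s -> okpath q /\ plen q = L) ->
  ad q0 * cyl_sum s * mn q0 = (count_mem q0 s)%:R * P (path_end q0).
Proof.
move=> o0 l0; elim: s => [|q s IH] hs; first by rewrite /cyl_sum big_nil mulr0 !mul0r.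
have [oq lq] := hs q (mem_head _ _).
rewrite /cyl_sum big_cons mulrDr mulrDl -/(cyl_sum s) IH; last by move=> b bs; apply: hs; rewrite inE bs orbT.
rewrite /= natrD mulrDl; congr (_ + _); have [->|/eqP nq] := eqVneq q q0.
  by rewrite mul1r mulrA (ad_mn hF) // -mulrA (ad_mn hF) // (famPP hF).
by rewrite mul0r mulrA (ad_mn0 hF) ?mul0r ?l0 ?lq //; exact: nesym.
Qed.

(** Compression by q^* and q reads off the multiplicity of q, an integer that torsion-freeness in
    characteristic 0 makes visible. *)
Lemma cyl_sum_perm L s s' : (forall q, q \in s -> okpath q /\ plen q = L) ->
  (forall q, q \in s' -> okpath q /\ plen q = L) -> cyl_sum s = cyl_sum s' -> perm_eq s s'.
Proof.
move=> hs hs' e; rewrite /perm_eq; apply/allP => q; rewrite mem_cat => hq; apply/eqP.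
have [oq lq] : okpath q /\ plen q = L by case/orP: hq; [exact: hs | exact: hs'].
apply: cplx_natr_inj; apply/eqP; rewrite -subr_eq0; apply/eqP.
apply: (pr_tors hp (v := path_end q)); first by apply: (scalB hS); exact: scaln hS _.
rewrite (ralgB hS hral) ?(ralgn hS hral); [|exact: scaln hS _|exact: scaln hS _].
by rewrite mulrBl -!(@count_cyl_sum q L) // e subrr.
Qed.

(** The scalars by which an idempotent acts on long paths are idempotent complex numbers, hence 0 or
    1. *)
Lemma idem_cyl_sum d : level d -> d * d = d -> exists L0, forall L, (L0 <= L)%N ->
  exists s, [/\ uniq s, forall q, q \in s -> [/\ okpath q, plen q = L & d * mn q = mn q] & d = cyl_sum s].
Proof.
move=> hd dd; have [L0 hL0] := level_sumE hS hp hns hd; exists L0 => L Lk.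
have [b [Sb hb] e] := hL0 L Lk.
have b01 q : q \in paths_of_len G L -> b q = 0 \/ b q = 1.
  rewrite mem_paths_of_len => /andP[oq /eqP lq].
  have /cplx_mul_eq0 [->|h] : b q * (b q - 1) = 0; [|by left|]; last first.
    by right; apply/eqP; rewrite -subr_eq0 h.
  have Sb1 : S (b q - 1) by apply: (scalB hS) => //; exact: scal1 hS.
  apply: (pr_tors hp (v := path_end q)); first exact: scalM hS _ _ (Sb q) Sb1.
  rewrite -(ad_mn hF oq) mulrA (ralgZ hral); last exact: scalM hS _ _ (Sb q) Sb1.
  have h1 := hb q oq; rewrite lq leqnn in h1; move/(_ erefl): h1 => h1.
  have h2 : d * (d * mn q) = d * mn q by rewrite mulrA dd.
  rewrite -mulrA mulrBr mulr1 (ralgB hS hral) //; last exact: scalM hS _ _ (Sb q) (Sb q).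
  rewrite mulrBl (ralgM hral) // -mulrA -h1 mulrA (ralgZ hral d (Sb q)) -mulrA -h1 h2.
  by rewrite subrr mulr0.
exists [seq q <- paths_of_len G L | b q == 1]; split.
- by rewrite filter_uniq // uniq_paths_of_len.
- move=> q; rewrite mem_filter mem_paths_of_len => /and3P[/eqP b1 oq /eqP lq]; split=> //.
  by rewrite hb ?lq // b1 (ralg1 hral) mul1r.
rewrite /cyl_sum big_filter e big_seq [RHS]big_seq_cond big_mkcondr /=; apply: eq_bigr => q qs.
case: eqP => [->|nb]; first by rewrite (ralg1 hral) mul1r.
by case: (b01 q qs) => // ->; rewrite (ralg0 hS hral) mul0r.
Qed.

Variables (K : fieldType) (t : K) (Lam : K -> Prop).
Hypothesis t0 : t != 0.
Hypothesis hL : subring_pred Lam.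
Hypothesis lam_t : forall z : int, Lam (t ^ z).

Definition wadj : 'M[K]_#|gV G| :=
  \matrix_(i, j) \sum_(e | (src e == enum_val i) && (rng e == enum_val j)) t ^ (c e).
Definition rel_mx : 'M[K]_#|gV G| := 1%:M - wadj.

Definition vtx (v : gV G) : 'rV[K]_#|gV G| := delta_mx 0 (enum_rank v).
Definition path_class (q : vpath G) : 'rV[K]_#|gV G| := t ^ (weight q) *: vtx (path_end q).
Definition cyl_class (s : seq (vpath G)) : 'rV[K]_#|gV G| := \sum_(q <- s) path_class q.

Local Notation congr := (congr_mod Lam rel_mx).

Lemma lam_path_class q : lam_mx Lam (path_class q).
Proof. by apply: (lam_mxZ hL) => //; exact: (lam_delta hL). Qed.
Lemma lam_cyl_class s : lam_mx Lam (cyl_class s).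
Proof.
rewrite /cyl_class; elim: s => [|q s IH]; first by rewrite big_nil; exact: (lam_mx0 hL).
by rewrite big_cons; apply: (lam_mxD hL) => //; exact: lam_path_class.
Qed.

Lemma vtx_wadj v : vtx v *m wadj = \sum_(e | src e == v) t ^ (c e) *: vtx (rng e).
Proof.
apply/rowP => j; rewrite -rowE !mxE summxE enum_rankK.
rewrite [RHS](eq_bigr (fun e => if rng e == enum_val j then t ^ (c e) else 0)) => [|e _]; last first.
  rewrite !mxE eqxx /= -(inj_eq enum_val_inj) enum_rankK eq_sym.
  by case: eqP; rewrite ?mulr1 ?mulr0.
by rewrite -big_mkcondr.
Qed.

Lemma path_class_step q : congr (path_class q) (\sum_(e <- enum (gE G) | src e == path_end q) path_class (catp q [:: e])).
Proof.
exists (path_class q); first exact: lam_path_class.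
rewrite /rel_mx mulmxBr mulmx1; congr (_ - _).
rewrite /path_class -scalemxAl vtx_wadj scaler_sumr big_enum_cond /=; apply: eq_bigr => e _.
rewrite weight_catp big_seq1 path_end_catp scalerA /=; congr (_ *: _).
by rewrite expfzDr.
Qed.

Lemma path_class_ext k q : okpath q -> congr (path_class q) (\sum_(p <- paths_from (path_end q) k) path_class (catp q p)).
Proof.
elim: k q => [|k IH] q oq; first by rewrite big_seq1 catp_nil; exact: congr_refl.
apply: congr_trans (path_class_step q) _ => //.
rewrite /= big_flatten big_map big_filter -big_filter -[X in congr_mod _ _ _ X]big_filter.
apply: (congr_sum hL) => e; rewrite mem_filter => /andP[/eqP se _].
rewrite big_map; have oqe : okpath (catp q [:: e]) by rewrite okpath_catp oq /= se eqxx.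
have := IH _ oqe; rewrite path_end_catp /=.
rewrite (eq_bigr (fun p => path_class (catp q (e :: p)))) // => p _.
by rewrite /catp /= -catA.
Qed.

Lemma refine_cyl_class L s : (forall q, q \in s -> okpath q) -> congr (cyl_class s) (cyl_class (refine L s)).
Proof.
move=> hs; rewrite /cyl_class big_flatten big_map; apply: (congr_sum hL) => q qs.
by rewrite big_map; apply: path_class_ext; exact: hs.
Qed.

(** The class depends only on the diagonal element: refinement preserves it, and at a common length
    equal sums are permutations of each other. *)
Lemma cyl_class_wd s s' : (forall q, q \in s -> okpath q) -> (forall q, q \in s' -> okpath q) ->
  cyl_sum s = cyl_sum s' -> congr (cyl_class s) (cyl_class s').
Proof.
move=> hs hs' e; pose L := \max_(q <- s ++ s') plen q.
have lL q : q \in s ++ s' -> (plen q <= L)%N by move=> h; exact: leq_bigmax_seq.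
have h1 q : q \in s -> okpath q /\ (plen q <= L)%N.
  by move=> qs; split; [exact: hs | apply: lL; rewrite mem_cat qs].
have h2 q : q \in s' -> okpath q /\ (plen q <= L)%N.
  by move=> qs; split; [exact: hs' | apply: lL; rewrite mem_cat qs orbT].
apply: (congr_trans hL) (refine_cyl_class L hs) _.
apply: (congr_trans hL) _ (congr_sym hL (refine_cyl_class L hs')).
have hp' : perm_eq (refine L s) (refine L s').
  apply: (@cyl_sum_perm L); last by rewrite !refine_cyl_sum.
    by move=> a /(refineP h1) [q [p [_ ? ? _ _]]].
  by move=> a /(refineP h2) [q [p [_ ? ? _ _]]].
by rewrite /cyl_class (perm_big _ hp'); exact: congr_refl.
Qed.

(** Refine until n takes each cylinder to a single one; every weight then grows by k and no endpoint
    changes. *)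
Lemma cyl_class_normalizer n k s : normalizer n -> HH k n ->
  (forall q, q \in s -> okpath q /\ st n * n * mn q = mn q) ->
  exists s', [/\ forall q, q \in s' -> okpath q, cyl_sum s' = n * cyl_sum s * st n &
                 congr (cyl_class s') (t ^ k *: cyl_class s)].
Proof.
move=> hn hk hs; have [L [f hf]] := normalizer_map hn hk.
have hs0 q : q \in s -> okpath q by move/hs => [].
pose L' := maxn L (\max_(q <- s) plen q).
have h1 q : q \in s -> okpath q /\ (plen q <= L')%N.
  move=> qs; split; first exact: hs0.
  by apply: leq_trans (leq_maxr _ _); exact: leq_bigmax_seq.
have h2 a : a \in refine L' s -> [/\ okpath (f a), path_end (f a) = path_end a, weight (f a) = k + weight a &
      mn (f a) * ad (f a) = n * (mn a * ad a) * st n].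
  move=> /(refineP h1) [q [p [qs oa la hpath ea]]]; apply: hf => //; first by rewrite la leq_maxl.
  have [oq nq] := hs q qs.
  by rewrite ea (mn_cat hF) // mulrA nq.
exists [seq f a | a <- refine L' s]; split.
- by move=> _ /mapP[a /h2[h _ _ _] ->].
- rewrite -(refine_cyl_sum L' hs0) /cyl_sum big_map mulr_sumr mulr_suml big_seq [RHS]big_seq.
  by apply: eq_bigr => a /h2 [].
apply: (congr_trans hL) _ (congr_sym hL (congrZ hL (lam_t k) (refine_cyl_class L' hs0))).
rewrite /cyl_class big_map scaler_sumr; apply: (congr_sum hL) => a /h2 [_ e1 e2 _].
by rewrite /path_class e1 e2 scalerA expfzDr //; exact: congr_refl.
Qed.
End Classes.

(** * Comparison of the two presentations *)

Section FittingDet.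
Variables (K : fieldType) (Lam : K -> Prop) (hL : subring_pred Lam).

Lemma rows_congr m n (M : 'M[K]_n) (A C : 'M[K]_(m, n)) :
  (forall i, congr_mod Lam M (row i A) (row i C)) -> exists2 W, lam_mx Lam W & A - C = W *m M.
Proof.
move=> h; have /choice [w hw] : forall i, exists w : 'rV[K]_n, lam_mx Lam w /\ row i A - row i C = w *m M.
  by move=> i; case: (h i) => w; exists w.
exists (\matrix_(i < m) w i) => [i j|]; first by rewrite mxE; case: (hw i).
apply/row_matrixP => i; rewrite row_mul rowK; case: (hw i) => _ <-.
by rewrite linearB.
Qed.

(* M1 and M2 present cokernels of which U and V are inverse isomorphisms; T = (M1 W; V Z) converts one
   presentation on n1 + n2 generators into the other. *)
Lemma fitting_det n1 n2 (M1 : 'M[K]_n1) (M2 : 'M[K]_n2) (U : 'M[K]_(n1, n2)) (V : 'M[K]_(n2, n1)) :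
  lam_mx Lam M1 -> lam_mx Lam V ->
  (forall i, congr_mod Lam M2 (row i (M1 *m U)) 0) ->
  (forall i, congr_mod Lam M2 (row i (V *m U)) (row i 1%:M)) ->
  exists2 a, Lam a & \det M1 = a * \det M2.
Proof.
move=> h1 hV hU hVU.
have [i|W hW eW] := @rows_congr _ _ M2 (M1 *m U) 0; first by rewrite linear0.
have [Z hZ eZ] := @rows_congr _ _ M2 (V *m U) 1%:M hVU.
rewrite subr0 in eW.
have e : block_mx M1 0 V (- 1%:M) = block_mx M1 W V Z *m block_mx 1%:M (- U) 0 M2.
  rewrite mulmx_block; congr block_mx; rewrite ?mulmx1 ?mulmx0 ?addr0 //.
    by rewrite mulmxN eW addNr.
  by rewrite mulmxN -eZ addrA addNr add0r.
have := congr1 determinant e; rewrite det_lblock det_mulmx det_ublock det1 mul1r.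
have dN : \det (- 1%:M : 'M[K]_n2) = (-1) ^+ n2 by rewrite -scaleN1r detZ det1 mulr1.
rewrite dN => e'; exists ((-1) ^+ n2 * \det (block_mx M1 W V Z)).
  apply: (lamM hL).
    rewrite -signr_odd; case: (odd _); rewrite ?expr1 ?expr0; last exact: lam1 hL.
    by apply: (lamN hL); exact: lam1 hL.
  apply: (lam_det hL) => i j; rewrite !mxE; case: splitP => k _; rewrite !mxE; case: splitP => l _ //.
by rewrite -mulrA -e' mulrCA -exprD addnn -signr_odd odd_double mulr1.
Qed.
End FittingDet.

Section Transfer.
Variables (S : cplx -> Prop) (hS : conj_closed_unital_subring S).
Variables (B : pzRingType) (iB : cplx -> B) (st : B -> B).
Variables (HH : int -> B -> Prop) (hgr : grading S iB HH).
Variables (K : fieldType) (t : K) (Lam : K -> Prop).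
Hypothesis t0 : t != 0.
Hypothesis hL : subring_pred Lam.
Hypothesis lam_t : forall z : int, Lam (t ^ z).

Variables (G1 : lgraph) (P1 : gV G1 -> B) (X1 Y1 : gE G1 -> B) (H1 : int -> B -> Prop).
Hypothesis (hp1 : leavitt_pres S iB st P1 X1 Y1 H1) (hG1 : branching G1).
Variable c1 : gE G1 -> int.
Hypothesis hP1 : forall v, HH 0 (P1 v).
Hypothesis hc1 : forall e, HH (c1 e) (X1 e).

Variables (G2 : lgraph) (P2 : gV G2 -> B) (X2 Y2 : gE G2 -> B) (H2 : int -> B -> Prop).
Hypothesis (hp2 : leavitt_pres S iB st P2 X2 Y2 H2) (hG2 : branching G2).
Variable c2 : gE G2 -> int.
Hypothesis hP2 : forall v, HH 0 (P2 v).
Hypothesis hc2 : forall e, HH (c2 e) (X2 e).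

Hypothesis lev12 : forall d, level S iB P1 X1 d <-> level S iB P2 X2 d.

Let hF1 := pr_fam hp1.

Lemma level_normalizer n : normalizer S iB st P1 X1 n -> normalizer S iB st P2 X2 n.
Proof.
move=> [h1 h2 h3]; split=> //; first by rewrite -lev12.
by move=> d; rewrite -!lev12; exact: h3.
Qed.

Lemma level_P v : level S iB P1 X1 (P1 v).
Proof.
have := level_proj hS hp1 (q0 := (v, [::])) isT.
by rewrite mn_nil ad_nil (famPP hF1).
Qed.

Lemma vertex_cover : exists sel : gV G1 -> seq (vpath G2), forall v,
  (forall q, q \in sel v -> okpath q /\ P1 v * mn P2 X2 q = mn P2 X2 q) /\
  cyl_sum P2 X2 Y2 (sel v) = P1 v.
Proof.
suff h : forall v, exists s, (forall q, q \in s -> okpath q /\ P1 v * mn P2 X2 q = mn P2 X2 q) /\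
  cyl_sum P2 X2 Y2 s = P1 v by have [sel hsel] := choice h; exists sel.
move=> v; have hl : level S iB P2 X2 (P1 v) by rewrite -lev12; exact: level_P.
have [L hL'] := idem_cyl_sum hS hp2 hG2 hl (famPP hF1 v).
by have [s [_ hs e]] := hL' L (leqnn L); exists s; split=> // q /hs [].
Qed.

Variable sel : gV G1 -> seq (vpath G2).
Hypothesis hsel : forall v,
  (forall q, q \in sel v -> okpath q /\ P1 v * mn P2 X2 q = mn P2 X2 q) /\
  cyl_sum P2 X2 Y2 (sel v) = P1 v.

(** The map of cokernels sending the class of v to that of a decomposition of [P1 v] into cylinders
    of the second family. *)
Definition transfer_mx : 'M[K]_(#|gV G1|, #|gV G2|) := \matrix_(i < #|gV G1|) cyl_class c2 t (sel (enum_val i)).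

Lemma lam_transfer : lam_mx Lam transfer_mx.
Proof. by move=> i j; rewrite mxE; exact: lam_cyl_class. Qed.

Lemma vtx_transfer v : vtx K v *m transfer_mx = cyl_class c2 t (sel v).
Proof. by rewrite -rowE rowK enum_rankK. Qed.

(** A cylinder q q^* is the conjugate of its end vertex by q, which also normalizes the diagonal
    seen from the second family; its degree is the weight of q. *)
Lemma transfer_cyl_sum s : (forall q, q \in s -> okpath q) -> exists s',
  [/\ forall q, q \in s' -> okpath q, cyl_sum P2 X2 Y2 s' = cyl_sum P1 X1 Y1 s &
      congr_mod Lam (rel_mx c2 t) (cyl_class c2 t s') (cyl_class c1 t s *m transfer_mx)].
Proof.
elim: s => [|q s IH] hs.
  by exists [::]; split=> //; rewrite /cyl_sum /cyl_class ?big_nil // mul0mx; exact: congr_refl.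
have [|s' [o' p' u']] := IH; first by move=> b bs; apply: hs; rewrite inE bs orbT.
have oq := hs q (mem_head _ _).
have stq := st_mn hp1 oq.
have [s1 s2] := hsel (path_end q).
have hn := level_normalizer (mn_normalizer hS hp1 oq).
have hk := HH_mn hp1 hgr hP1 hc1 oq.
have ha a : a \in sel (path_end q) -> okpath a /\ st (mn P1 X1 q) * mn P1 X1 q * mn P2 X2 a = mn P2 X2 a.
  by move=> /s1 [oa ea]; split=> //; rewrite stq (ad_mn hF1).
have [s'' [o'' p'' u'']] := cyl_class_normalizer hS hp2 hG2 hgr hP2 hc2 t0 hL lam_t hn hk ha.
exists (s'' ++ s'); split.
- by move=> a; rewrite mem_cat => /orP[/o''|/o'].
- by rewrite cyl_sum_cat p'' p' s2 stq (mn_end hF1) // /cyl_sum big_cons.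
rewrite /cyl_class big_cat big_cons mulmxDl; apply: (congrD hL) => //.
apply: (congr_trans hL) u'' _; rewrite /path_class -scalemxAl vtx_transfer; exact: congr_refl.
Qed.

Lemma cyl_class1 v : cyl_class c1 t [:: (v, [::])] = vtx K v.
Proof. by rewrite /cyl_class big_seq1 /path_class /weight big_nil expr0z scale1r. Qed.

(** Row i encodes [P1 v] as the sum of all e e^* with e leaving v: two expressions of one
    projection, so their transferred classes agree. *)
Lemma transfer_rel i : congr_mod Lam (rel_mx c2 t) (row i (rel_mx c1 t *m transfer_mx)) 0.
Proof.
set v := enum_val i; pose le := [seq (v, [:: e]) | e <- enum (gE G1) & src e == v].
have ole q : q \in le -> okpath q.
  by move=> /mapP[e]; rewrite mem_filter => /andP[se _] ->; rewrite /okpath /= se.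
have ov q : q \in [:: (v, [::])] -> okpath q by rewrite inE => /eqP ->.
have [s1 [o1 p1 u1]] := transfer_cyl_sum ov; have [s2 [o2 p2 u2]] := transfer_cyl_sum ole.
have pe : cyl_sum P1 X1 Y1 [:: (v, [::])] = cyl_sum P1 X1 Y1 le.
  rewrite /cyl_sum big_seq1 mn_nil ad_nil (famPP hF1) big_map big_filter (famP hF1); last by case: hG1.
  rewrite big_enum_cond /=; apply: eq_bigr => e /eqP <-.
  by rewrite (mn_cons hF1) (ad_cons hF1) mn_nil ad_nil (famXP hF1) (famPY hF1).
have e : cyl_class c1 t [:: (v, [::])] - cyl_class c1 t le = row i (rel_mx c1 t).
  rewrite /rel_mx linearB /= row1 cyl_class1 /vtx enum_valK; congr (_ - _).
  rewrite rowE -[i]enum_valK -/v -/(vtx K v) vtx_wadj /cyl_class big_map big_filter big_enum_cond /=.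
  by apply: eq_bigr => f _; rewrite /path_class /weight big_seq1.
rewrite row_mul -e mulmxBl -(subrr (cyl_class c2 t s2)).
apply: (congrD hL).
  apply: (congr_trans hL) (congr_sym hL u1) _; apply: (cyl_class_wd hS hp2 hG2) => //.
  by rewrite p1 p2.
rewrite -!scaleN1r; apply: (congrZ hL); last exact: (congr_sym hL u2).
by apply: (lamN hL); exact: lam1 hL.
Qed.

Lemma lam_rel : lam_mx Lam (rel_mx c1 t).
Proof.
move=> i j; rewrite !mxE; apply: (lamB hL).
  by case: (i == j); [exact: lam1 hL | exact: lam0 hL].
by apply: (lam_sum hL) => e _.
Qed.
End Transfer.

Section Comparison.
Variables (S : cplx -> Prop) (hS : conj_closed_unital_subring S).
Variables (B : pzRingType) (iB : cplx -> B) (st : B -> B).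
Variables (HH : int -> B -> Prop) (hgr : grading S iB HH).
Variables (K : fieldType) (t : K) (Lam : K -> Prop).
Hypothesis t0 : t != 0.
Hypothesis hL : subring_pred Lam.
Hypothesis lam_t : forall z : int, Lam (t ^ z).

Variables (G1 : lgraph) (P1 : gV G1 -> B) (X1 Y1 : gE G1 -> B) (H1 : int -> B -> Prop).
Hypothesis (hp1 : leavitt_pres S iB st P1 X1 Y1 H1) (hG1 : branching G1).
Variable c1 : gE G1 -> int.
Hypothesis hP1 : forall v, HH 0 (P1 v).
Hypothesis hc1 : forall e, HH (c1 e) (X1 e).

Variables (G2 : lgraph) (P2 : gV G2 -> B) (X2 Y2 : gE G2 -> B) (H2 : int -> B -> Prop).
Hypothesis (hp2 : leavitt_pres S iB st P2 X2 Y2 H2) (hG2 : branching G2).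
Variable c2 : gE G2 -> int.
Hypothesis hP2 : forall v, HH 0 (P2 v).
Hypothesis hc2 : forall e, HH (c2 e) (X2 e).

Hypothesis lev12 : forall d, level S iB P1 X1 d <-> level S iB P2 X2 d.

(** Transferring a vertex of G2 to G1 and back yields cylinders that again sum to this vertex, so by
    [cyl_class_wd] the composite is the identity on classes. *)
Lemma comparison_det : exists2 a, Lam a & \det (rel_mx c1 t) = a * \det (rel_mx c2 t).
Proof.
have lev21 d : level S iB P2 X2 d <-> level S iB P1 X1 d by rewrite lev12.
have [sel hsel] := vertex_cover hS hp1 hp2 hG2 lev12.
have [sel' hsel'] := vertex_cover hS hp2 hp1 hG1 lev21.
have hF2 := pr_fam hp2.
apply: (fitting_det hL (U := transfer_mx t c2 sel) (V := transfer_mx t c1 sel')).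
- exact: lam_rel.
- exact: lam_transfer.
- by move=> i; exact: (transfer_rel hS hgr t0 hL lam_t hp1 hG1 hP1 hc1 hp2 hG2 hP2 hc2 lev12 hsel).
move=> i; rewrite row_mul rowK row1; set v := enum_val i.
have [s1 s2] := hsel' v.
have o1 q : q \in sel' v -> okpath q by move/s1 => [].
have [s' [o' p' u']] := transfer_cyl_sum hS hgr t0 hL lam_t hp1 hP1 hc1 hp2 hG2 hP2 hc2 lev12 hsel o1.
apply: (congr_trans hL) (congr_sym hL u') _.
rewrite -(enum_valK i) -/v -/(vtx K v) -(cyl_class1 t c2).
apply: (cyl_class_wd hS hp2 hG2) => //; first by move=> q; rewrite inE => /eqP ->.
by rewrite p' s2 /cyl_sum big_seq1 mn_nil ad_nil (famPP hF2).
Qed.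
End Comparison.

(** * Weights of closed paths and determinants *)

Section Positivity.
Variables (S : cplx -> Prop) (hS : conj_closed_unital_subring S).
Variables (B : pzRingType) (iB : cplx -> B) (st : B -> B).
Variables (G1 : lgraph) (P1 : gV G1 -> B) (X1 Y1 : gE G1 -> B) (H1 : int -> B -> Prop).
Hypothesis (hp1 : leavitt_pres S iB st P1 X1 Y1 H1) (hG1 : branching G1).
Variables (G2 : lgraph) (P2 : gV G2 -> B) (X2 Y2 : gE G2 -> B) (H2 : int -> B -> Prop).
Hypothesis (hp2 : leavitt_pres S iB st P2 X2 Y2 H2) (hG2 : branching G2).
Variable c1 : gE G1 -> int.
Hypothesis hP1 : forall v, H2 0 (P1 v).
Hypothesis hc1 : forall e, H2 (c1 e) (X1 e).
Hypothesis lev12 : forall d, level S iB P1 X1 d <-> level S iB P2 X2 d.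

Let hF1 := pr_fam hp1.
Let hF2 := pr_fam hp2.

Lemma weight_plen (q : vpath G2) : weight (fun=> 1) q = (plen q)%:Z.
Proof.
rewrite /weight /plen; elim: q.2 => [|e p IH]; first by rewrite big_nil.
by rewrite big_cons IH /=; lia.
Qed.

Lemma size_refine (L : nat) (s : seq (vpath G2)) :
  size (refine L s) = (\sum_(q <- s) size (paths_from (path_end q) (L - plen q)))%N.
Proof.
rewrite /refine; elim: s => [|q s IH]; first by rewrite big_nil.
by rewrite big_cons /= size_cat size_map IH.
Qed.

(* If the weight were nonpositive, conjugation by the closed path would carry the cylinders that
   partition its base vertex to cylinders of at most the same length. Cut to a common length these are
   at least as many as before, yet they fill only a proper part of the vertex. *)
Lemma closed_weight_pos v p : gpath v p -> p != [::] -> gend v p = v -> 0 < weight c1 (v, p).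
Proof.
move=> hpath pn cl; rewrite ltNge; apply/negP => wle.
have oq : okpath (v, p) by [].
have eq : path_end (v, p) = v by [].
set q := (v, p) in oq eq wle; set k := weight c1 q in wle.
have stq := st_mn hp1 oq.
have hn := level_normalizer lev12 (mn_normalizer hS hp1 oq).
have hk := HH_mn hp1 (pr_grad hp2) hP1 hc1 oq.
have [L [f hf]] := normalizer_map hS hp2 hG2 (pr_grad hp2) (pr_P hp2) (pr_X hp2) hn hk.
have lP : level S iB P2 X2 (P1 v) by rewrite -lev12; exact: (level_P hS hp1).
pose m := mn P1 X1 q * ad P1 Y1 q.
have lm : level S iB P2 X2 m by rewrite -lev12; exact: (level_proj hS hp1 oq).
have mm : m * m = m by rewrite /m -!mulrA (mulrA (ad P1 Y1 q)) (ad_mn hF1) // (ad_end hF1).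
have Pm : P1 v * m = m by rewrite /m mulrA (P_mn hF1 q).
have mP : m * P1 v = m by rewrite /m -mulrA (ad_P hF1 q).
have ld : level S iB P2 X2 (P1 v - m).
  rewrite -[- m]mul1r -(ralg1 (pr_alg hp2)) mulrN -mulNr -(ralgN hS (pr_alg hp2)); last exact: scal1 hS.
  apply: (levelD hS hp2) => //; apply: (levelM hS hp2) => //; apply: level_scal.
  by apply: (scalN hS); exact: scal1 hS.
have dd : (P1 v - m) * (P1 v - m) = P1 v - m.
  by rewrite mulrBl !mulrBr (famPP hF1) Pm mP mm subrr subr0.
have [La hLa] := idem_cyl_sum hS hp2 hG2 lP (famPP hF1 v).
have [Lb hLb] := idem_cyl_sum hS hp2 hG2 ld dd.
have [s [us hs ps]] := hLa (maxn L La) (leq_maxr _ _).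
set L1 := maxn L La in hs.
(* A common length: cylinders of s have length L1, their images under f are no longer since k is at
   most 0, and [P1 v - m] splits at length L2. *)
pose L2 := maxn L1 Lb.
have [s2 [us2 hs2 ps2]] := hLb L2 (leq_maxr _ _).
have ha a : a \in s -> [/\ okpath (f a), path_end (f a) = path_end a, (plen (f a))%:Z = k + (plen a)%:Z &
    mn P2 X2 (f a) * ad P2 Y2 (f a) = mn P1 X1 q * (mn P2 X2 a * ad P2 Y2 a) * st (mn P1 X1 q)].
  move=> /hs [oa la ea]; rewrite -!weight_plen; apply: hf => //; first by rewrite la leq_maxl.
  by rewrite stq (ad_mn hF1) // eq ea.
have pf : cyl_sum P2 X2 Y2 (map f s) = m.
  transitivity (mn P1 X1 q * cyl_sum P2 X2 Y2 s * st (mn P1 X1 q)).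
    rewrite /cyl_sum big_map mulr_sumr mulr_suml big_seq [RHS]big_seq.
    by apply: eq_bigr => a /ha [].
  by rewrite -ps stq -eq (mn_end hF1).
have h1 a : a \in s -> okpath a /\ (plen a <= L2)%N.
  by move=> /hs [oa -> _]; rewrite leq_maxl.
have h2 a : a \in map f s -> okpath a /\ (plen a <= L2)%N.
  move=> /mapP[b bs ->]; have [ofb _ lfb _] := ha b bs; split=> //.
  by have [_ lb] := h1 b bs; lia.
have hperm : perm_eq (refine L2 s) (refine L2 (map f s) ++ s2).
  apply: (cyl_sum_perm hS hp2 (L := L2)).
  - by move=> a /(refineP h1) [? [? [_ ? ? _ _]]].
  - move=> a; rewrite mem_cat => /orP[/(refineP h2) [? [? [_ ? ? _ _]]] //|/hs2[]//].
  have r1 : cyl_sum P2 X2 Y2 (refine L2 s) = cyl_sum P2 X2 Y2 s.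
    by apply: (refine_cyl_sum hp2 hG2) => a /h1 [].
  have r2 : cyl_sum P2 X2 Y2 (refine L2 (map f s)) = cyl_sum P2 X2 Y2 (map f s).
    by apply: (refine_cyl_sum hp2 hG2) => a /h2 [].
  by rewrite cyl_sum_cat r1 r2 pf -ps -ps2 addrC subrK.
have := perm_size hperm; rewrite size_cat !size_refine big_map.
(* f keeps endpoints and does not lengthen, so [f a] has at least as many extensions to length L2 as
   a. *)
have hle : (\sum_(a <- s) size (paths_from (path_end a) (L2 - plen a)) <=
            \sum_(a <- s) size (paths_from (path_end (f a)) (L2 - plen (f a))))%N.
  rewrite big_seq [leqRHS]big_seq; apply: leq_sum => a as_; have [_ -> lfa _] := ha a as_.
  by apply: leq_size_paths_from; [case: hG2 | lia].
move=> hsz; have : size s2 = 0%N.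
  by move: hle; rewrite hsz -[leqRHS]addn0 leq_add2l leqn0 => /eqP.
move/size0nil => s20; rewrite s20 /cyl_sum big_nil in ps2.
(* Now [P1 v] would be the projection of p alone; branching gives another path p' of the same length
   from v, nonzero and orthogonal to p. *)
have [p' hp' [sp' np']] := proj2 hG1 _ _ hpath pn cl.
have op' : okpath (v, p') by [].
apply: (mn_neq0 hS hp1 op'); rewrite -[mn _ _ _](P_mn hF1 (v, p')) /=.
have -> : P1 v = m by apply/eqP; rewrite -subr_eq0 ps2.
rewrite /m -mulrA (ad_mn0 hF1 (q := q)) ?mulr0 //.
by move=> [pp']; apply: np'.
Qed.
End Positivity.

(** * Laurent polynomials: order at 0 and value at 1 *)

Section Laurent.
Local Notation "x %:F" := (tofrac x).
Local Notation K := {fraction {poly int}}.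
Local Notation t := (('X : {poly int})%:F : K).

Lemma t_neq0 : t != 0.
Proof. by rewrite tofrac_eq0 polyX_eq0. Qed.

Definition laurent (x : K) := exists (k : nat) (p : {poly int}), x * t ^+ k = p%:F.

Lemma laurent_subring : subring_pred laurent.
Proof.
split.
- by exists 0%N, 1; rewrite mulr1 tofrac1.
- move=> x y [k [p hp]] [l [q hq]]; exists (k + l)%N, (p * 'X^l - q * 'X^k).
  by rewrite tofracB !tofracM !tofracXn -hp -hq exprD; ring.
- move=> x y [k [p hp]] [l [q hq]]; exists (k + l)%N, (p * q).
  by rewrite tofracM -hp -hq exprD; ring.
Qed.

Lemma laurent_t (z : int) : laurent (t ^ z).
Proof.
case: z => n; first by exists 0%N, ('X^n); rewrite mulr1 tofracXn.
exists n.+1, 1; rewrite NegzE -exprnN mulVf ?tofrac1 //.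
by rewrite expf_neq0 // t_neq0.
Qed.

(** Carries two data at once: order at least k at t = 0, and the value a at t = 1. *)
Definition laurent_at (x : K) (a : int) (k : int) :=
  exists2 p : {poly int}, x = t ^ k * p%:F & p.[1] = a.

Lemma laurent_at0 k : laurent_at 0 0 k.
Proof. by exists 0; rewrite ?tofrac0 ?mulr0 ?horner0. Qed.
Lemma laurent_atD x y a b k : laurent_at x a k -> laurent_at y b k -> laurent_at (x + y) (a + b) k.
Proof. by move=> [p -> <-] [q -> <-]; exists (p + q); rewrite ?hornerD // tofracD mulrDr. Qed.
Lemma laurent_atN x a k : laurent_at x a k -> laurent_at (- x) (- a) k.
Proof. by move=> [p -> <-]; exists (- p); rewrite ?hornerN // tofracN mulrN. Qed.
Lemma laurent_atM x y a b k l : laurent_at x a k -> laurent_at y b l -> laurent_at (x * y) (a * b) (k + l).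
Proof.
move=> [p -> <-] [q -> <-]; exists (p * q); rewrite ?hornerM // tofracM expfzDr ?t_neq0 //.
by ring.
Qed.
Lemma laurent_at_t k : laurent_at (t ^ k) 1 k.
Proof. by exists 1; rewrite ?hornerC // tofrac1 mulr1. Qed.
Lemma laurent_at1 : laurent_at 1 1 0.
Proof. exact: laurent_at_t 0. Qed.
Lemma laurent_atW x a k l : l <= k -> laurent_at x a k -> laurent_at x a l.
Proof.
move=> lk [p -> <-]; exists ('X^(absz (k - l)) * p); last by rewrite hornerM hornerXn expr1n mul1r.
rewrite tofracM tofracXn mulrA; congr (_ * _).
have -> : k = l + (absz (k - l))%:Z by lia.
by rewrite expfzDr ?t_neq0 //; congr (_ * _ ^+ _); lia.
Qed.
Lemma laurent_at_sum (I : Type) (s : seq I) (p : pred I) (F : I -> K) (a : I -> int) k :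
  (forall i, p i -> laurent_at (F i) (a i) k) ->
  laurent_at (\sum_(i <- s | p i) F i) (\sum_(i <- s | p i) a i) k.
Proof.
move=> h; apply: (big_ind2 (fun x y => laurent_at x y k)) => //; first exact: laurent_at0.
by move=> *; exact: laurent_atD.
Qed.
Lemma laurent_at_prod (I : Type) (s : seq I) (F : I -> K) (a k : I -> int) :
  (forall i, laurent_at (F i) (a i) (k i)) ->
  laurent_at (\prod_(i <- s) F i) (\prod_(i <- s) a i) (\sum_(i <- s) k i).
Proof.
move=> h; elim: s => [|i s IH]; first by rewrite !big_nil; exact: laurent_at1.
by rewrite !big_cons; exact: laurent_atM.
Qed.

Lemma laurent_at_sub1M x y a b : laurent_at (x - 1) (a - 1) 1 -> laurent_at (y - 1) (b - 1) 1 ->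
  laurent_at (x * y - 1) (a * b - 1) 1.
Proof.
move=> hx hy.
have -> : x * y - 1 = (x - 1) * (y - 1) + ((x - 1) + (y - 1)) by ring.
have -> : a * b - 1 = (a - 1) * (b - 1) + ((a - 1) + (b - 1)) by ring.
apply: laurent_atD; last exact: laurent_atD.
by apply: laurent_atW (laurent_atM hx hy).
Qed.

(** As q(0) = 1, X is prime to q; evaluation at 0 removes one factor X at a time. *)
Lemma X_dvd_coprime (k : nat) (p q a : {poly int}) : q.[0] = 1 -> p * 'X^k = a * q ->
  exists2 a', a = a' * 'X^k & p = a' * q.
Proof.
move=> q0; elim: k p => [|k IH] p; first by rewrite mulr1 => ->; exists a; rewrite ?mulr1.
rewrite exprS mulrA => /IH [b -> e].
have /factor_theorem [b' eb] : root b 0.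
  have := congr1 (horner^~ 0) e; rewrite !hornerM hornerX mulr0 q0 mulr1 => /esym h.
  by apply/rootP.
rewrite subr0 in eb; exists b'; first by rewrite eb -mulrA.
by apply: (mulIf (negbT (polyX_eq0 int))); rewrite e eb; ring.
Qed.

(** Both elements are polynomials with constant term 1, so powers of t cancel from the mutual
    divisibility, which then holds in Z[X]. The quotient is a unit, hence constant, and constant
    terms make it 1, not -1. *)
Lemma laurent_unit_eq x y a b d1 d2 : laurent a -> laurent b -> x = a * y -> y = b * x ->
  laurent_at (x - 1) (d1 - 1) 1 -> laurent_at (y - 1) (d2 - 1) 1 -> d1 = d2.
Proof.
move=> [k [al hal]] [l [be hbe]] exy eyx [r1 h1 v1] [r2 h2 v2].
pose p : {poly int} := 1 + 'X * r1; pose q : {poly int} := 1 + 'X * r2.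
have xp : x = p%:F by rewrite /p tofracD tofrac1 tofracM -[t]expr1z -h1 addrC subrK.
have yq : y = q%:F by rewrite /q tofracD tofrac1 tofracM -[t]expr1z -h2 addrC subrK.
have p0 : p.[0] = 1 by rewrite /p hornerD hornerM hornerX mul0r addr0 hornerC.
have q0 : q.[0] = 1 by rewrite /q hornerD hornerM hornerX mul0r addr0 hornerC.
have p1 : p.[1] = d1 by rewrite /p hornerD hornerM hornerX mul1r hornerC v1; lia.
have q1 : q.[1] = d2 by rewrite /q hornerD hornerM hornerX mul1r hornerC v2; lia.
have e1 : p * 'X^k = al * q.
  by apply/eqP; rewrite -tofrac_eq !tofracM tofracXn -xp -yq -hal exy; apply/eqP; ring.
have e2 : q * 'X^l = be * p.
  by apply/eqP; rewrite -tofrac_eq !tofracM tofracXn -xp -yq -hbe eyx; apply/eqP; ring.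
have [a' _ pa] := X_dvd_coprime q0 e1; have [b' _ qb] := X_dvd_coprime p0 e2.
have pn : p != 0 by apply/eqP => h; move: p0; rewrite h horner0.
have ab : a' * b' = 1.
  by apply: (mulIf pn); rewrite mul1r -mulrA -qb -pa.
have a1 : a' = 1.
  have : a' \is a GRing.unit by apply/unitrPr; exists b'.
  rewrite poly_unitE => /andP[/eqP /eqP/size_poly1P[c cn ec] _].
  have := congr1 (horner^~ 0) pa; rewrite hornerM p0 q0 mulr1 ec hornerC => <-.
  by [].
by rewrite -p1 -q1 pa a1 mul1r.
Qed.

Section WeightedDet.
Variables (G : lgraph) (c : gE G -> int).
Hypothesis cpos : forall v p, gpath v p -> p != [::] -> gend v p = v -> 0 < weight c (v, p).

Lemma perm_weight_pos (T : finType) (s : {perm T}) (w : T -> gV G) (e : T -> gE G) :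
  injective w -> s != 1%g ->
  (forall i, s i != i -> src (e i) = w i /\ rng (e i) = w (s i)) ->
  0 < \sum_i (if s i == i then 0 else c (e i)).
Proof.
move=> wi s1 he; pose f i := if s i == i then 0 else c (e i).
(* The order of s is a common period of all its cycles, so s need not be decomposed. *)
rewrite -/(\sum_i f i); pose m := #[s]%g.
have m0 : (0 < m)%N by exact: order_gt0.
have shift k : \sum_i f i = \sum_i f ((s ^+ k)%g i).
  by rewrite [LHS](reindex_inj (@perm_inj _ (s ^+ k)%g)).
(* Summing over all iterates of s turns the sum over its cycles into weights of closed walks. *)
have hm : (\sum_i f i) *+ m = \sum_i \sum_(k < m) f ((s ^+ k)%g i).
  rewrite exchange_big /= -[in LHS](card_ord m) -sumr_const; apply: eq_bigr => k _.
  exact: shift.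
have fixedX i k : s i = i -> (s ^+ k)%g i = i.
  by move=> h; elim: k => [|k IH]; rewrite ?expg0 ?perm1 // expgSr permM IH h.
have movedX i k : s i != i -> s ((s ^+ k)%g i) != (s ^+ k)%g i.
  move=> h; apply: contra h => /eqP h; apply/eqP.
  by apply: (@perm_inj _ (s ^+ k)%g); rewrite -!permM -expgS expgSr permM.
pose wlk i k := [seq e ((s ^+ j)%g i) | j <- iota 0 k].
have walk i k : s i != i -> gpath (w i) (wlk i k) /\ gend (w i) (wlk i k) = w ((s ^+ k)%g i).
  move=> hi; elim: k => [|k [h1 h2]]; first by rewrite /wlk /= expg0 perm1.
  have [se re] := he _ (movedX i k hi).
  have -> : wlk i k.+1 = wlk i k ++ [:: e ((s ^+ k)%g i)].
    by rewrite /wlk -addn1 iotaD map_cat.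
  rewrite gpath_cat gend_cat h1 h2 /= se eqxx /gend /= re; split=> //.
  by rewrite expgSr permM.
have pos i : s i != i -> 0 < \sum_(k < m) f ((s ^+ k)%g i).
  move=> hi; have [h1 h2] := walk i m hi.
  have -> : \sum_(k < m) f ((s ^+ k)%g i) = weight c (w i, wlk i m).
    rewrite /weight /wlk /= big_map -[in RHS](subn0 m) -/(index_iota 0 m) big_mkord.
    by apply: eq_bigr => k _; rewrite /f (negbTE (movedX i k hi)).
  apply: cpos => //; last by rewrite h2 expg_order perm1.
  by rewrite -size_eq0 size_map size_iota -lt0n.
have nn i : 0 <= \sum_(k < m) f ((s ^+ k)%g i).
  have [h|h] := eqVneq (s i) i; last exact: ltW (pos i h).
  by rewrite big1 // => k _; rewrite /f fixedX // h eqxx.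
have [i hi] : exists i, s i != i.
  apply: contrapT => no; case/eqP: s1; apply/permP => i; rewrite perm1.
  by apply/eqP; apply: contrapT => h; apply: no; exists i; apply/negP.
have : 0 < (\sum_i f i) *+ m.
  rewrite hm (bigD1 i) //=; apply: ltr_pwDl; first exact: pos.
  by apply: sumr_ge0 => j _; exact: nn.
by rewrite pmulrn_lgt0.
Qed.

(* In the permutation expansion of det(1 - A_c(t)), the term of s <> 1 has as exponent a sum of weights
   of disjoint closed paths, hence vanishes at t = 0. *)
Lemma det_rel_laurent :
  laurent_at (\det (rel_mx c t) - 1) (\det (1%:M - adjmx G) - 1) 1.
Proof.
pose w (i : 'I_#|gV G|) := enum_val i.
have adjE i j : adjmx G i j = \sum_(e | (src e == w i) && (rng e == w j)) 1.
  rewrite mxE -sum1_card -natz natr_sum; apply: eq_big => e //; by rewrite inE.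
have adj_at i j k : (forall e, src e = w i -> rng e = w j -> k <= c e) ->
    laurent_at (wadj c t i j) (adjmx G i j) k.
  move=> h; rewrite adjE mxE; apply: laurent_at_sum => e /andP[/eqP h1 /eqP h2].
  by apply: laurent_atW (laurent_at_t _); exact: h.
have loop_at i : laurent_at (wadj c t i i) (adjmx G i i) 1.
  apply: adj_at => e h1 h2; have := @cpos (w i) [:: e].
  rewrite /weight /= big_seq1 h1 eqxx /gend /= h2 => h; have : 0 < c e by apply: h.
  by lia.
have relE i j : rel_mx c t i j = (i == j)%:R - wadj c t i j.
  by rewrite mxE [X in _ + X]mxE [X in X + _]mxE.
have idE i j : (1%:M - adjmx G) i j = (i == j)%:R - adjmx G i j.
  by rewrite mxE [X in _ + X]mxE [X in X + _]mxE.
have diag_at i : laurent_at (rel_mx c t i i - 1) ((1%:M - adjmx G) i i - 1) 1.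
  by rewrite relE idE eqxx ![1%:R - _]addrC !addrK; apply: laurent_atN.
have off_at i j k : i != j -> (forall e, src e = w i -> rng e = w j -> k <= c e) ->
    laurent_at (rel_mx c t i j) ((1%:M - adjmx G) i j) k.
  by move=> ij h; rewrite relE idE (negbTE ij) !sub0r; apply: laurent_atN; exact: adj_at.
rewrite /determinant (bigD1 1%g) //= [X in laurent_at _ (X - 1)](bigD1 1%g) //=.
rewrite odd_perm1 !mul1r [X in laurent_at X]addrAC [X in laurent_at _ X]addrAC; apply: laurent_atD.
  elim/big_ind2: _ => [|x a y b|i _]; first by rewrite !subrr; exact: laurent_at0.
    exact: laurent_at_sub1M.
  by rewrite perm1.
apply: laurent_at_sum => s s1.
have sgn x a k : laurent_at x a k -> laurent_at ((-1) ^+ s * x) ((-1) ^+ s * a) k.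
  by case: (odd_perm s) => h; rewrite ?expr1 ?expr0 ?mulN1r ?mul1r //; exact: laurent_atN.
apply: sgn.
(* If some moved i has no edge to s i, the term is 0 on both sides; otherwise s runs along edges of
   G. *)
have [[i [si no]]|ex] := pselect (exists i, s i != i /\ forall e, ~ (src e = w i /\ rng e = w (s i))).
  rewrite (bigD1 i) //= [X in laurent_at _ X](bigD1 i) //=.
  have z1 : wadj c t i (s i) = 0.
    by rewrite mxE big_pred0 // => e; apply/negP => /andP[/eqP h1 /eqP h2]; apply: (no e).
  have z2 : adjmx G i (s i) = 0.
    by rewrite adjE big_pred0 // => e; apply/negP => /andP[/eqP h1 /eqP h2]; apply: (no e).
  have -> : rel_mx c t i (s i) = 0.
    by rewrite relE eq_sym (negbTE si) z1 subr0.
  have -> : (1%:M - adjmx G) i (s i) = 0.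
    by rewrite idE eq_sym (negbTE si) z2 subr0.
  by rewrite !mul0r; exact: laurent_at0.
(* Among parallel edges, one of least weight bounds the order of the entry (i, s i). [None] is the
   value at fixed points. *)
have /choice [e he] : forall i, exists e0 : option (gE G), s i != i ->
    exists e, [/\ e0 = Some e, src e = w i, rng e = w (s i) &
      forall e', src e' = w i -> rng e' = w (s i) -> c e <= c e'].
  move=> i; have [h|h] := eqVneq (s i) i; first by exists None.
  have [e1 [h1 h2]] : exists e, src e = w i /\ rng e = w (s i).
    apply: contrapT => no; apply: ex; exists i; split=> // e hh; apply: no; by exists e.
  pose pr : pred (gE G) := fun e => (src e == w i) && (rng e == w (s i)).
  have h0 : pr e1 by rewrite /pr h1 h2 !eqxx.
  case: (Order.TotalTheory.arg_minP (P := pr) c h0) => e /andP[/eqP ha /eqP hb] hmin.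
  exists (Some e) => _; exists e; split=> // e' hc hd; apply: hmin; by rewrite /pr hc hd !eqxx.
have [allfix|nofix] := pselect (forall i, s i = i).
  by case/eqP: s1; apply/permP => i; rewrite perm1 allfix.
have [i0 hi0] : exists i, s i != i.
  by apply: contrapT => no; apply: nofix => i; apply/eqP; apply: contrapT => h; apply: no; exists i; apply/negP.
have [e00 _] := he i0 hi0.
pose f i := odflt e00 (e i).
have hf i : s i != i -> [/\ src (f i) = w i, rng (f i) = w (s i) &
      forall e', src e' = w i -> rng e' = w (s i) -> c (f i) <= c e'].
  by move=> /he [e' [ee h1 h2 h3]]; rewrite /f ee.
have hpos := @perm_weight_pos _ s w f enum_val_inj s1.
have {}hpos : 0 < \sum_i (if s i == i then 0 else c (f i)).
  by apply: hpos => i /hf [].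
apply: (@laurent_atW _ _ (\sum_i (if s i == i then 0 else c (f i)))); first by lia.
apply: laurent_at_prod => i; case: eqP => [h|/eqP h].
  (* At a fixed point the entry is 1 plus a multiple of t, so it has order at least 0. *)
  rewrite h -[rel_mx _ _ _ _](subrK 1) -[X in laurent_at _ X](subrK 1).
  by apply: laurent_atD; [apply: laurent_atW (diag_at i) | exact: laurent_at1].
by have [_ _ hmin] := hf i h; apply: off_at => //; rewrite eq_sym.
Qed.
End WeightedDet.
End Laurent.

(** * Homogeneous edges and the conclusion *)

Section Homogenization.
Variables (S : cplx -> Prop) (hS : conj_closed_unital_subring S).
Variables (B : pzRingType) (iB : cplx -> B) (st : B -> B).
Variables (E : lgraph) (P1 : gV E -> B) (X1 Y1 : gE E -> B) (H1 : int -> B -> Prop).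
Hypothesis (hp1 : leavitt_pres S iB st P1 X1 Y1 H1) (hE : branching E).
Variables (F : lgraph) (P2 : gV F -> B) (X2 Y2 : gE F -> B) (H2 : int -> B -> Prop).
Hypothesis (hp2 : leavitt_pres S iB st P2 X2 Y2 H2) (hF : branching F).
Hypothesis lev12 : forall d, level S iB P1 X1 d <-> level S iB P2 X2 d.

Let hF1 := pr_fam hp1.
Let hF2 := pr_fam hp2.
Let hns2 : nosink F. Proof. by case: hF. Qed.

Lemma edge_normalizer e : normalizer S iB st P2 X2 (X1 e).
Proof.
apply: (level_normalizer lev12).
have oe : okpath (src e, [:: e]) by rewrite /okpath /= eqxx.
by have := mn_normalizer hS hp1 oe; rewrite (mn_cons hF1) mn_nil (famXP hF1).
Qed.

Lemma edge_single_bound : exists L, forall e q, okpath q -> (L <= plen q)%N ->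
  X1 e * mn P2 X2 q = 0 \/
  exists b a, [/\ S b, b <> 0, okpath a, path_end a = path_end q & X1 e * mn P2 X2 q = iB b * mn P2 X2 a].
Proof.
have /choice [Lf hLf] := fun e => normalizer_single hS hp2 hF (edge_normalizer e).
exists (\max_e Lf e)%N => e q oq Lq; apply: hLf => //.
by apply: leq_trans Lq; exact: (leq_bigmax e).
Qed.

(** The projections of length L of F are also diagonal for E, and there are finitely many, so one N
    serves them all. *)
Lemma cylinder_level_bound L : exists N, forall m q, okpath m -> plen m = L -> okpath q -> (N <= plen q)%N ->
  exists2 b, S b & mn P2 X2 m * ad P2 Y2 m * mn P1 X1 q = iB b * mn P1 X1 q.
Proof.
have /choice [Nf hNf] : forall m, exists N, okpath m -> forall q, okpath q -> (N <= plen q)%N ->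
  exists2 b, S b & mn P2 X2 m * ad P2 Y2 m * mn P1 X1 q = iB b * mn P1 X1 q.
  move=> m; have [om|nm] := boolP (okpath m); last by exists 0%N.
  have : level S iB P1 X1 (mn P2 X2 m * ad P2 Y2 m) by rewrite lev12; exact: (level_proj hS hp2).
  by move=> [N hN]; exists N.
exists (\max_(m <- paths_of_len F L) Nf m)%N => m q om lm oq Nq; apply: hNf => //.
apply: leq_trans Nq; apply: leq_bigmax_seq => //.
by rewrite mem_paths_of_len om lm eqxx.
Qed.

(* Every edge X1 e acts as a single monomial on each long cylinder of F, and each P v of a high iterated
   line graph lies below such a cylinder; hence its edges X1 e * P v are homogeneous for the F-grading. *)
Lemma homogeneous_linegraph : exists (G : lgraph) (P : gV G -> B) (X Y : gE G -> B) (c : gE G -> int),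
  [/\ leavitt_pres S iB st P X Y H1, branching G, forall d, level S iB P X d <-> level S iB P2 X2 d,
      \det (1%:M - adjmx G) = \det (1%:M - adjmx E) &
      (forall v, H2 0 (P v)) /\ forall x, H2 (c x) (X x)].
Proof.
have [L hL] := edge_single_bound; have [N hN] := cylinder_level_bound L.
have [G [P [X [Y [hp hG lev hdet [hX hP]]]]]] := iterated_linegraph hS hp1 hE N.
have hFG := pr_fam hp.
have lev2 d : level S iB P X d <-> level S iB P2 X2 d by rewrite lev lev12.
have HP v : H2 0 (P v).
  by apply: (level_H0 hS hp2 hns2); rewrite -lev2; exact: (level_P hS hp).
(* Each length-L projection of F acts on [P v] by an idempotent scalar; these projections sum to 1
   and [P v] is nonzero, so some scalar is 1. *)
have one_cyl v : exists m, [/\ okpath m, plen m = L & mn P2 X2 m * ad P2 Y2 m * P v = P v].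
  apply: contrapT => no; apply: (P_neq0 hS hp (v := v)).
  rewrite -[P v]mul1r -(sum_paths_of_len hF2 hns2 L) mulr_suml big_seq big1 // => m.
  rewrite mem_paths_of_len => /andP[om /eqP lm]; have [q [oq lq eq]] := hP v.
  have [|b Sb hb] := hN m q om lm oq; first by rewrite lq.
  have hb' : mn P2 X2 m * ad P2 Y2 m * P v = iB b * P v by rewrite eq mulrA hb mulrA.
  have /cplx_mul_eq0 [b0|b1] : b * (b - 1) = 0.
    apply: (pr_tors hp (v := v)).
      by apply: (scalM hS) => //; apply: (scalB hS) => //; exact: scal1 hS.
    have idm : mn P2 X2 m * ad P2 Y2 m * (mn P2 X2 m * ad P2 Y2 m) = mn P2 X2 m * ad P2 Y2 m.
      by rewrite -!mulrA (mulrA (ad P2 Y2 m)) (ad_mn hF2) // (ad_end hF2).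
    rewrite mulrBr mulr1 (ralgB hS (pr_alg hp)) //; last exact: (scalM hS Sb Sb).
    rewrite mulrBl (ralgM (pr_alg hp)) // -mulrA -hb' mulrA (ralgZ (pr_alg hp)) // -mulrA -hb'.
    by rewrite mulrA idm subrr.
  - by rewrite hb' b0 (ralg0 hS (pr_alg hp)) mul0r.
  case: no; exists m; split=> //.
  have e1 : b = 1 by apply/eqP; rewrite -subr_eq0 b1.
  by rewrite hb' e1 (ralg1 (pr_alg hp)) mul1r.
have /choice [c hc] : forall x, exists k, H2 k (X x).
  move=> x; have [e ->] := hX x; have [m [om lm em]] := one_cyl (rng x).
  (* With m m^* inserted, the edge is (X1 e m)(m^* P): the first factor is 0 or a scalar times a
     path of F, the second has degree minus the length of m. *)
  have Hm k a : H2 k a -> H2 (k + (- (plen m)%:Z + 0)) (a * (ad P2 Y2 m * P (rng x))).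
    move=> ha; apply: (gradingM (pr_grad hp2)) => //; apply: (gradingM (pr_grad hp2)) => //.
    exact: (H_ad hp2).
  have -> : X1 e * P (rng x) = X1 e * mn P2 X2 m * (ad P2 Y2 m * P (rng x)).
    by rewrite -{1}em !mulrA.
  case: (hL e m om); first by rewrite lm.
    by move=> ->; rewrite mul0r; exists 0; exact: (grading0 (pr_grad hp2)).
  move=> [b [a [Sb _ oa _ ->]]]; eexists; apply: Hm.
  by apply: (gradingZ (pr_grad hp2)) => //; exact: (H_mn hp2 oa).
by exists G, P, X, Y, c.
Qed.

Lemma det_eq_of_common_diagonal : \det (1%:M - adjmx E) = \det (1%:M - adjmx F).
Proof.
have [G [P [X [Y [c [hp hG lev2 <- [HP Hc]]]]]]] := homogeneous_linegraph.
have lev2' d : level S iB P2 X2 d <-> level S iB P X d by rewrite lev2.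
have h2P := pr_P hp2; have h2X := pr_X hp2; have hgr := pr_grad hp2.
have [a la ea] := comparison_det hS hgr t_neq0 laurent_subring laurent_t
  hp hG HP Hc hp2 hF h2P h2X lev2.
have [b lb eb] := comparison_det hS hgr t_neq0 laurent_subring laurent_t
  hp2 hF h2P h2X hp hG HP Hc lev2'.
apply: (laurent_unit_eq la lb ea eb); apply: det_rel_laurent => v p hpath pn cl.
  exact: (closed_weight_pos hS hp hG hp2 hF HP Hc lev2 hpath pn cl).
by rewrite (weight_plen (v, p)) /plen /=; case: (p) pn.
Qed.
End Homogenization.

Theorem theorem3p6 (E F : lgraph) (S : cplx -> Prop)
  (hS : conj_closed_unital_subring S)
  (hEess : essential E) (hEsc : strongly_connected E) (hEL : condition_L E)
  (hFess : essential F) (hFsc : strongly_connected F) (hFL : condition_L F)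
  (A : pzRingType) (iA : cplx -> A) (stA : A -> A)
  (PA : gV E -> A) (XA YA : gE E -> A)
  (hA : is_LPA S iA stA PA XA YA)
  (B : pzRingType) (iB : cplx -> B) (stB : B -> B)
  (PB : gV F -> B) (XB YB : gE F -> B)
  (hB : is_LPA S iB stB PB XB YB)
  (phi : A -> B)
  (hphi : star_iso S iA iB stA stB phi)
  (hdiag : forall x, in_diagonal S iA PA XA YA x -> in_diagonal S iB PB XB YB (phi x)) :
  sgz (\det (1%:M - adjmx E)) = sgz (\det (1%:M - adjmx F)).
Proof.
have gE' := branching_of_conditionL hEess hEL; have gF := branching_of_conditionL hFess hFL.
have [HA hpA] := lpa_leavitt_pres hS hA (proj1 gE'); have [HB hpB] := lpa_leavitt_pres hS hB (proj1 gF).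
case: hphi => -[psi phiK psiK] phiD phiM phiZ phi_st.
have hp1 := transport_leavitt_pres hS phiK psiK phiD phiM phiZ phi_st (pr_alg hpB) hpA.
have lev d : level S iB (phi \o PA) (phi \o XA) d -> level S iB PB XB d.
  rewrite (level_diag hS hp1 gE') (level_diag hS hpB gF) => -[n [c [v [p [h ->]]]]].
  pose x := \sum_(i < n) iA (c i) * (path_mono PA XA (v i) (p i) * path_adj PA YA (v i) (p i)).
  have := hdiag x; rewrite /x (phi_sum phiD).
  rewrite (eq_bigr (fun i => iB (c i) * (path_mono (phi \o PA) (phi \o XA) (v i) (p i) *
     path_adj (phi \o PA) (phi \o YA) (v i) (p i)))) => [|i _]; first by apply; exists n, c, v, p.
  have [Sc _] := h i; rewrite phiZ // phiM.
  have := phi_mn PA XA psiK phiM (v i, p i); have := phi_ad PA YA psiK phiM (v i, p i).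
  by rewrite !mnE !adE => -> ->.
congr sgz; apply: (det_eq_of_common_diagonal hS hp1 gE' hpB gF) => d; split; first exact: lev.
(* Reverse inclusion: d commutes with the image of the diagonal of L(E), as that image lies in the
   commutative diagonal of L(F); maximality puts d into it. *)
move=> hd; apply: (level_max_comm hS hp1 gE') => d' /lev hd'.
exact: (levelC hpB (proj1 gF)).
Qed.
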